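(* Let $A$ be an $n\times n$ real matrix with characteristic polynomial $\det(\lambda I-A)=\lambda^n+c_1\lambda^{n-1}+\cdots+c_n$ and singular values $\sigma_1\ge\cdots\ge\sigma_n$, and let $1\le k\le n$. Let $H$ be a real upper Hessenberg matrix orthogonally similar to $A$, and let $\tilde H=H+E$ be the upper Hessenberg matrix computed in floating point arithmetic by applying Householder similarity transformations to $A$, where $\|E\|_F\le \nu_2 n^2\|A\|_F\,u$ for a constant $\nu_2>0$. Assume the floating point assumptions stated in the context and that $\|A\|_F<1/(\nu_2 n^2u)$. Let $\tilde c_j$ be the coefficients of the characteristic polynomial $\det(\lambda I-\tilde H)=\lambda^n+\tilde c_1\lambda^{n-1}+\cdots+\tilde c_n$, let $\mathrm{fl}[\tilde c_j]$ be the coefficients computed by applying La Budde's method for upper Hessenberg matrices (recursion in the context) to $\tilde H$ in floating point arithmetic, and let $\rho_j$ be the corresponding running error bounds defined in the context. Then $$\left|\mathrm{fl}[\tilde{c}_j]-c_j\right|\leq \binom{n}{j}s_{j-1}^{(j)}\, \nu_2 n^2\|A\|_F\,u+\rho_j+\mathcal{O}\left(u^2\right),\qquad 1\leq j\leq k,$$ where $s_0^{(1)}=1$ and $s_{j-1}^{(j)}=\sum_{1\leq i_1<\cdots<i_{j-1}\leq j}\sigma_{i_1}\cdots\sigma_{i_{j-1}}$ is the $(j-1)$st elementary symmetric function of the $j$ largest singular values of $A$.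
   Context: This is a first order bound: $\mathcal O(u^2)$ refers to $u\to0$ with $A$, $n$, $\nu_2$ fixed. $\|\cdot\|_F$ is the Frobenius norm. Floating point assumptions: all matrix elements are normalized real floating point numbers; $u$ is the unit roundoff and $nu<1$; no operation underflows or overflows; $\mathrm{fl}[\cdot]$ denotes the result computed in floating point arithmetic. For $\mathrm{op}\in\{+,-,\times,/\}$ and normalized real floating point numbers $x,y$ such that $x\ \mathrm{op}\ y$ does not underflow or overflow, $\mathrm{fl}[x\ \mathrm{op}\ y]=(x\ \mathrm{op}\ y)(1+\delta)$ for some $|\delta|\le u$, and also $\mathrm{fl}[x\ \mathrm{op}\ y]=(x\ \mathrm{op}\ y)/(1+\epsilon)$ for some $|\epsilon|\le u$. $\gamma_m=\frac{mu}{1-mu}$, where $mu<1$ is understood for every $\gamma_m$ that occurs. The computed value $\mathrm{fl}[\text{sum of products}]$ means: each product of several numbers (with $b_{i,m}$ below written out as its $m+1$ factors) is computed by successive floating point multiplications, and the computed products are then added in floating point from left to right (in the order $m=1,2,\ldots$, with the product not involving a $\hat c$ added last). Let $h_{ij}$ be the elements of $\tilde H$, $\alpha_i=h_{ii}$ its diagonal and $\beta_i=h_{i,i-1}$ its subdiagonal elements. Write $b_{i,m}=h_{i-m,i}\,\beta_i\beta_{i-1}\cdots\beta_{i-m+1}$ for $1\le m\le i-1$. Empty sums are zero. Computed recursion (for $j\le k$): $\hat c_1^{(1)}=-\alpha_1$ (exact); $\hat{c}_1^{(i)}=\mathrm{fl}[\hat{c}_1^{(i-1)}-\alpha_i]$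 for $2\le i\le n$; $\hat c_2^{(2)}=\mathrm{fl}[\mathrm{fl}[\alpha_1\alpha_2]-\mathrm{fl}[h_{12}\beta_2]]$; $\hat c_2^{(i)}=\mathrm{fl}[\mathrm{fl}[\hat c_2^{(i-1)}-\mathrm{fl}[\alpha_i\hat c_1^{(i-1)}]]-\mathrm{fl}[h_{i-1,i}\beta_i]]$ for $3\le i\le n$; $\hat c_i^{(i)}=-\mathrm{fl}\big[\mathrm{fl}[\alpha_i\hat c_{i-1}^{(i-1)}]+\mathrm{fl}[\sum_{m=1}^{i-2}b_{i,m}\hat c_{i-m-1}^{(i-m-1)}+b_{i,i-1}]\big]$ for $3\le i\le k$; $\hat c_j^{(i)}=\mathrm{fl}\big[\mathrm{fl}[\hat c_j^{(i-1)}-\mathrm{fl}[\alpha_i\hat c_{j-1}^{(i-1)}]]-\mathrm{fl}[\sum_{m=1}^{j-2}b_{i,m}\hat c_{j-m-1}^{(i-m-1)}+b_{i,j-1}]\big]$ for $3\le j\le k$, $j+1\le i\le n$. The output is $\mathrm{fl}[\tilde c_j]=\hat c_j^{(n)}$, $1\le j\le k$. Running error bounds: define nonnegative numbers $\rho_j^{(i)}$ by $\rho_1^{(1)}=0$; $\rho_1^{(i)}=\rho_1^{(i-1)}+u|\hat c_1^{(i)}|$ for $2\le i\le n$; $\rho_2^{(2)}=u(|\alpha_2\alpha_1|+|h_{12}\beta_2|+|\hat c_2^{(2)}|)$; $\rho_2^{(i)}=\rho_2^{(i-1)}+|\alpha_i|\rho_1^{(i-1)}+u(|\hat c_2^{(i-1)}|+|h_{i-1,i}\beta_i|+|\hat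 c_2^{(i)}|)+\gamma_2|\alpha_i\hat c_1^{(i-1)}|$ for $3\le i\le n$; $\rho_i^{(i)}=|\alpha_i|\rho_{i-1}^{(i-1)}+\sum_{m=1}^{i-2}|b_{i,m}|\rho_{i-m-1}^{(i-m-1)}+\gamma_{i+1}\sum_{m=2}^{i-2}|b_{i,m}\hat c_{i-m-1}^{(i-m-1)}|+\gamma_i(|b_{i,1}\hat c_{i-2}^{(i-2)}|+|b_{i,i-1}|)+u(|\hat c_i^{(i)}|+|\alpha_i\hat c_{i-1}^{(i-1)}|)$ for $3\le i\le k$; $\rho_j^{(i)}=\rho_j^{(i-1)}+|\alpha_i|\rho_{j-1}^{(i-1)}+\sum_{m=1}^{j-2}|b_{i,m}|\rho_{j-m-1}^{(i-m-1)}+\gamma_{j+1}\sum_{m=2}^{j-2}|b_{i,m}\hat c_{j-m-1}^{(i-m-1)}|+\gamma_j(|b_{i,1}\hat c_{j-2}^{(i-2)}|+|b_{i,j-1}|)+u(|\hat c_j^{(i)}|+|\hat c_j^{(i-1)}|)+\gamma_2|\alpha_i\hat c_{j-1}^{(i-1)}|$ for $3\le j\le k$, $j+1\le i\le n$. Finally $\rho_j=\rho_j^{(n)}$ for $1\le j\le k$. *)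

(* Defs.v *)
From mathcomp Require Import all_boot all_order all_algebra.
From mathcomp Require Import reals.

Set Implicit Arguments.
Unset Strict Implicit.
Unset Printing Implicit Defensive.

Import Order.TTheory GRing.Theory Num.Theory.
Local Open Scope ring_scope.

Section Matrices.
Variables (R : realType) (n : nat).
Implicit Types A H Q : 'M[R]_n.

Definition frob A : R := Num.sqrt (\sum_i \sum_j A i j ^+ 2).

Definition upper_hessenberg H : Prop :=
  forall i j : 'I_n, (j.+1 < i)%N -> H i j = 0.

Definition orthogonally_similar H A : Prop :=
  exists2 Q, Q^T *m Q = 1%:M & H = Q^T *m A *m Q.

(* det (lambda I - A) = \sum_j charcoef A j * lambda ^ (n - j), for j <= n *)
Definition charcoef A (j : nat) : R := (char_poly A)`_(n - j).

(* Nonincreasing nonnegative square roots of the eigenvalues of A^T A, the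
   latter counted with multiplicity. *)
Definition singular_values A (sigma : 'I_n -> R) : Prop :=
  [/\ forall i, 0 <= sigma i,
      forall i j : 'I_n, (i <= j)%N -> sigma j <= sigma i
    & char_poly (A^T *m A) = \prod_i ('X - (sigma i ^+ 2)%:P)].

(* r-th elementary symmetric function of sigma_1, ..., sigma_m (1-based) *)
Definition elem_sym (sigma : 'I_n -> R) (r m : nat) : R :=
  \sum_(S : {set 'I_n} | (#|S| == r) && (S \subset [set i : 'I_n | (i < m)%N]))
    \prod_(i in S) sigma i.

(* Entries with 1-based indices; only 1 <= i, j <= n is meaningful. *)
Definition entry A (i j : nat) : R :=
  match insub i.-1, insub j.-1 with
  | Some i', Some j' => A i' j'
  | _, _ => 0
  end.

End Matrices.

Section FloatingPoint.
Variable R : realType.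

Inductive fop := Add | Sub | Mul | Div.

Definition exact_op (o : fop) (x y : R) : R :=
  match o with
  | Add => x + y
  | Sub => x - y
  | Mul => x * y
  | Div => x / y
  end.

(* An arithmetic with unit roundoff u.  [fp_num] is the set of floating point
   numbers: the normalized ones, possibly together with 0 (needed for the
   structural zeros of a Hessenberg matrix).  [fp_safe o x y] says that x o y
   neither underflows nor overflows (nor divides by zero). *)
Record fp_arith (u : R) := FpArith {
  fp_num : R -> Prop;
  fp_safe : fop -> R -> R -> Prop;
  fp_op : fop -> R -> R -> R;
  fp_numN : forall x, fp_num x -> fp_num (- x);
  fp_num_op : forall o x y, fp_num x -> fp_num y -> fp_safe o x y ->
    fp_num (fp_op o x y);
  fp_op_mulE : forall o x y, fp_num x -> fp_num y -> fp_safe o x y ->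
    exists2 d, `|d| <= u & fp_op o x y = exact_op o x y * (1 + d);
  fp_op_divE : forall o x y, fp_num x -> fp_num y -> fp_safe o x y ->
    exists2 e, `|e| <= u & fp_op o x y = exact_op o x y / (1 + e)
}.

Inductive expr := Lit of R | Op of fop & expr & expr.

Fixpoint flval u (F : fp_arith u) (e : expr) : R :=
  match e with
  | Lit x => x
  | Op o e1 e2 => fp_op F o (flval F e1) (flval F e2)
  end.

Fixpoint flsafe u (F : fp_arith u) (e : expr) : Prop :=
  match e with
  | Lit _ => True
  | Op o e1 e2 =>
      [/\ flsafe F e1, flsafe F e2 & fp_safe F o (flval F e1) (flval F e2)]
  end.

(* v = fl[e], every operation in e being rounded and none of them underflowing
   or overflowing *)
Definition computes u (F : fp_arith u) (e : expr) (v : R) : Prop :=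
  flsafe F e /\ v = flval F e.

(* ((e1 o e2) o e3) o ... *)
Definition chain (o : fop) (es : seq expr) : expr :=
  if es is e :: es' then foldl (Op o) e es' else Lit 0.

(* v = fl[\sum_t \prod_(x in t) x]: the products are added from left to right;
   inside a product the factors are multiplied one after the other, in an order
   that is left free. *)
Definition computes_sum_prods u (F : fp_arith u) (ts : seq (seq R)) (v : R) :
    Prop :=
  exists2 ts', all2 perm_eq ts' ts
    & computes F (chain Add [seq chain Mul (map Lit t) | t <- ts']) v.

Definition gam (u : R) (m : nat) : R := m%:R * u / (1 - m%:R * u).

End FloatingPoint.

Declare Scope fl_scope.
Delimit Scope fl_scope with FL.
Bind Scope fl_scope with expr.
Notation "x + y" := (Op Add x y) : fl_scope.
Notation "x - y" := (Op Sub x y) : fl_scope.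
Notation "x * y" := (Op Mul x y) : fl_scope.
Notation "# x" := (Lit x%R) (at level 2, x at level 1, format "# x") : fl_scope.

Section LaBudde.
Variables (R : realType) (u : R) (F : fp_arith u) (n k : nat) (Ht : 'M[R]_n).

Local Notation h := (entry Ht).
Local Notation alpha i := (h i i).
Local Notation beta i := (h i i.-1).

(* h_{i-m,i}, beta_i, beta_{i-1}, ..., beta_{i-m+1} *)
Definition b_factors (i m : nat) : seq R :=
  h (i - m) i :: [seq beta (i - t) | t <- iota 0 m].

Definition b_elt (i m : nat) : R := \prod_(x <- b_factors i m) x.

Local Notation b := b_elt.

(* In both structures [c j i] stands for \hat c_j^{(i)} and [rho j i] for
   \rho_j^{(i)}. *)

Definition labudde_terms (c : nat -> nat -> R) (j i : nat) : seq (seq R) :=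
  rcons [seq rcons (b_factors i m) (c (j - m - 1)%N (i - m - 1)%N)
        | m <- iota 1 (j - 2)]
        (b_factors i (j - 1)).

Record labudde_computed (c : nat -> nat -> R) : Prop := LabuddeComputed {
  lb_c11 : c 1%N 1%N = - alpha 1;
  lb_c1 : forall i, (2 <= i <= n)%N ->
    computes F (#(c 1%N i.-1) - #(alpha i))%FL (c 1%N i);
  lb_c22 : (2 <= k)%N ->
    computes F (#(alpha 1) * #(alpha 2) - #(h 1 2) * #(beta 2))%FL (c 2%N 2%N);
  lb_c2 : (2 <= k)%N -> forall i, (3 <= i <= n)%N ->
    computes F (#(c 2%N i.-1) - #(alpha i) * #(c 1%N i.-1)
                - #(h i.-1 i) * #(beta i))%FL (c 2%N i);
  lb_cii : forall i, (3 <= i <= k)%N ->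
    exists2 s, computes_sum_prods F (labudde_terms c i i) s
      & computes F (#(alpha i) * #(c i.-1 i.-1) + #s)%FL (- c i i);
  lb_cji : forall j i, (3 <= j <= k)%N -> (j.+1 <= i <= n)%N ->
    exists2 s, computes_sum_prods F (labudde_terms c j i) s
      & computes F (#(c j i.-1) - #(alpha i) * #(c j.-1 i.-1) - #s)%FL (c j i)
}.

Record running_error_bounds (c rho : nat -> nat -> R) : Prop :=
    RunningErrorBounds {
  re_11 : rho 1%N 1%N = 0;
  re_1 : forall i, (2 <= i <= n)%N ->
    rho 1%N i = rho 1%N i.-1 + u * `|c 1%N i|;
  re_22 : (2 <= k)%N ->
    rho 2%N 2%N = u * (`|alpha 2 * alpha 1| + `|h 1 2 * beta 2| + `|c 2%N 2%N|);
  re_2 : (2 <= k)%N -> forall i, (3 <= i <= n)%N ->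
    rho 2%N i = rho 2%N i.-1 + `|alpha i| * rho 1%N i.-1
      + u * (`|c 2%N i.-1| + `|h i.-1 i * beta i| + `|c 2%N i|)
      + gam u 2 * `|alpha i * c 1%N i.-1|;
  re_ii : forall i, (3 <= i <= k)%N ->
    rho i i = `|alpha i| * rho i.-1 i.-1
      + \sum_(1 <= m < i.-1) `|b i m| * rho (i - m - 1)%N (i - m - 1)%N
      + gam u i.+1
        * \sum_(2 <= m < i.-1) `|b i m * c (i - m - 1)%N (i - m - 1)%N|
      + gam u i * (`|b i 1 * c (i - 2)%N (i - 2)%N| + `|b i (i - 1)|)
      + u * (`|c i i| + `|alpha i * c i.-1 i.-1|);
  re_ji : forall j i, (3 <= j <= k)%N -> (j.+1 <= i <= n)%N ->
    rho j i = rho j i.-1 + `|alpha i| * rho j.-1 i.-1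
      + \sum_(1 <= m < j.-1) `|b i m| * rho (j - m - 1)%N (i - m - 1)%N
      + gam u j.+1
        * \sum_(2 <= m < j.-1) `|b i m * c (j - m - 1)%N (i - m - 1)%N|
      + gam u j * (`|b i 1 * c (j - 2)%N (i - 2)%N| + `|b i (j - 1)|)
      + u * (`|c j i| + `|c j i.-1|)
      + gam u 2 * `|alpha i * c j.-1 i.-1|
}.

End LaBudde.

(* Main.v *)
(* Rounding errors and perturbation are treated separately.

   Rounding: the exact coefficients of the characteristic polynomials of the
   leading principal blocks of a Hessenberg matrix obey the recursion of La
   Budde's method, so by induction along that recursion the error of every
   computed coefficient is at most its running error bound, with no second
   order term.

   Perturbation: up to sign, the j-th coefficient is the sum of the principal
   minors of order j, so its first order change under E pairs the entries of E
   with minors of order j - 1 of H.  By Cauchy-Schwarz, this is at most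
   frob E times the root of binom(n, j) (n - j + 1) times the sum of all squared
   minors of order j - 1, which by Cauchy-Binet is the elementary symmetric
   function e_(j-1) of the squares of all n singular values.  Since the average
   of the products of r of the m largest singular values decreases with m,
   passing from all n to the j largest ones gives binom(n, j) s_(j-1)^(j).  No
   singular value decomposition or interlacing is needed. *)
Require Import Defs.
From mathcomp Require Import all_boot all_order all_algebra.
From mathcomp Require Import fingroup perm reals ring lra.

Set Implicit Arguments.
Unset Strict Implicit.
Unset Printing Implicit Defensive.

Import Order.TTheory GRing.Theory Num.Theory.
Local Open Scope ring_scope.

(** * Coefficients of the characteristic polynomial as sums of minors *)

Lemma det_mxsub_noninj (R : comNzRingType) (n r : nat) (M : 'M[R]_n)
    (f g : 'I_r -> 'I_n) :
  ~~ injectiveb f -> \det (mxsub f g M) = 0.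
Proof.
case/injectivePn=> i1 [i2 ne12 f12].
by rewrite (determinant_alternate ne12) // => q; rewrite !mxE f12.
Qed.

Lemma det_mxsub_permr (R : comNzRingType) (n r : nat) (M : 'M[R]_n)
    (f g : 'I_r -> 'I_n) (s : 'S_r) :
  \det (mxsub f (g \o s) M) = (-1) ^+ s * \det (mxsub f g M).
Proof.
have -> : mxsub f (g \o s) M = col_perm s (mxsub f g M).
  by apply/matrixP=> i q; rewrite !mxE.
by rewrite col_permE det_mulmx det_perm odd_permV mulrC.
Qed.

(** Each row of $BC$ is a combination of the rows of $C$; multilinearity of the determinant picks
    one row [f i] of $C$ for every [i]. *)
Lemma det_mulmx_ffun (R : comNzRingType) (n r : nat) (B : 'M[R]_(r, n))
    (C : 'M[R]_(n, r)) :
  \det (B *m C)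
    = \sum_(f : {ffun 'I_r -> 'I_n}) (\prod_i B i (f i)) * \det (rowsub f C).
Proof.
transitivity (\sum_(f : {ffun 'I_r -> 'I_n}) \sum_(s : 'S_r)
    (-1) ^+ s * \prod_i (B i (f i) * C (f i) (s i))).
  rewrite exchange_big; apply: eq_bigr => /= s _; rewrite -big_distrr /=.
  congr (_ * _); rewrite -(bigA_distr_bigA (fun i q => B i q * C q (s i))) /=.
  by apply: eq_bigr => x _; rewrite mxE.
apply: eq_bigr => f _; rewrite big_distrr /=; apply: eq_bigr => s _.
rewrite big_split /= mulrCA; congr (_ * (_ * _)).
by apply: eq_bigr => i _; rewrite mxE.
Qed.

(* Cauchy-Binet, summed over all maps instead of the increasing ones, which
   counts every r-subset r! times. *)
Lemma cauchy_binet (R : comNzRingType) (n r : nat) (B : 'M[R]_(r, n))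
    (C : 'M[R]_(n, r)) :
  \sum_(f : {ffun 'I_r -> 'I_n}) \det (colsub f B) * \det (rowsub f C)
    = r`!%:R * \det (B *m C).
Proof.
transitivity (\sum_(s : 'S_r) \det (B *m C)); last first.
  by rewrite sumr_const card_Sn mulr_natl.
under eq_bigr do rewrite [X in X * _]/(\det _) big_distrl.
rewrite exchange_big; apply: eq_bigr => /= s _; rewrite det_mulmx_ffun.
(* For each [s] in the expansion of the first determinant, substituting $f\circ s^{-1}$ for [f]
   moves [s] into the second determinant, where its sign cancels; every [s] then contributes
   $\det(BC)$. *)
pose h (t : 'S_r) (f : {ffun 'I_r -> 'I_n}) := [ffun i => f (t i)].
have hK t : cancel (h t) (h t^-1)%g.
  by move=> f; apply/ffunP=> i; rewrite !ffunE permKV.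
rewrite (reindex_inj (can_inj (hK s^-1)%g)) /=; apply: eq_bigr => f _.
have -> : rowsub (h s^-1%g f) C = row_perm s^-1 (rowsub f C).
  by apply/matrixP=> i q; rewrite !mxE ffunE.
rewrite row_permE det_mulmx det_perm odd_permV.
have -> : \prod_i (colsub (h s^-1%g f) B) i (s i) = \prod_i B i (f i).
  by apply: eq_bigr => i _; rewrite mxE ffunE permK.
by rewrite mulrACA mulrA -signr_addb addbb mul1r.
Qed.

(** For fixed columns [g], Cauchy-Binet turns the sum over the row choices [f] into a Gram
    determinant, a principal minor of $M^TM$. *)
Lemma sum_sqr_minors (R : comNzRingType) (n r : nat) (M : 'M[R]_n) :
  \sum_(f : {ffun 'I_r -> 'I_n}) \sum_(g : {ffun 'I_r -> 'I_n})
      \det (mxsub f g M) ^+ 2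
    = r`!%:R * \sum_(g : {ffun 'I_r -> 'I_n}) \det (mxsub g g (M^T *m M)).
Proof.
rewrite exchange_big big_distrr; apply: eq_bigr => /= g _.
rewrite mxsub_mul -cauchy_binet; apply: eq_bigr => f _.
have -> : colsub f (rowsub g M^T) = (mxsub f g M)^T.
  by apply/matrixP=> i q; rewrite !mxE.
have -> : rowsub f (colsub g M) = mxsub f g M.
  by apply/matrixP=> i q; rewrite !mxE.
by rewrite det_tr.
Qed.

(** Sylvester's identity: one block matrix has two block triangular factorizations. *)
Lemma det_1addmulC (R : comNzRingType) (m n : nat) (F : 'M[R]_(m, n))
    (G : 'M[R]_(n, m)) :
  \det (1%:M + F *m G) = \det (1%:M + G *m F).
Proof.
have eq1 : block_mx 1%:M (- F) G 1%:M
    = block_mx 1%:M 0 G 1%:M *m block_mx 1%:M (- F) 0 (1%:M + G *m F).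
  rewrite mulmx_block !mul1mx !mulmx1 !mul0mx ?mulmx0 !addr0 mulmxN.
  by congr block_mx; rewrite addrCA addNr addr0.
have eq2 : block_mx 1%:M (- F) G 1%:M
    = block_mx (1%:M + F *m G) (- F) 0 1%:M *m block_mx 1%:M 0 G 1%:M.
  by rewrite mulmx_block !mul1mx !mulmx1 !mul0mx ?mulmx0 !add0r mulNmx addrK.
have := congr1 determinant (etrans (esym eq1) eq2).
by rewrite !det_mulmx !det_ublock !det_lblock !det1 !mul1r !mulr1.
Qed.

(* The principal minor of [M] on the rows and columns in [S], written as a
   determinant of full size. *)
Definition principal_mx (R : comNzRingType) (n : nat) (M : 'M[R]_n)
    (S : {set 'I_n}) : 'M[R]_n :=
  \matrix_(i, q) if i \in S then M i q else (i == q)%:R.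

(** The matrix has the form $I+FG$ where $F$ has only $r$ columns, so Sylvester's identity brings
    its determinant down to order $r$. *)
Lemma det_principal_mx (R : comNzRingType) (n r : nat) (M : 'M[R]_n)
    (f : 'I_r -> 'I_n) :
  injective f ->
  \det (principal_mx M [set f x | x in 'I_r]) = \det (mxsub f f M).
Proof.
move=> f_inj; pose F : 'M[R]_(n, r) := \matrix_(i, a) (i == f a)%:R.
have -> : principal_mx M [set f x | x in 'I_r]
    = 1%:M + F *m rowsub f (M - 1%:M).
  apply/matrixP=> i q; rewrite !mxE.
  case: imsetP => [[a _ ->]|notf].
    rewrite (bigD1 a) //= big1 => [|b neq_ba].
      by rewrite !mxE eqxx mul1r addr0 addrC subrK.
    by rewrite !mxE (inj_eq f_inj) eq_sym (negPf neq_ba) mul0r.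
  rewrite big1 ?addr0 // => a _; rewrite !mxE.
  by case: eqP => [def_i|]; rewrite ?mul0r //; case: notf; exists a.
rewrite det_1addmulC; congr (\det _); apply/matrixP=> a b; rewrite !mxE.
rewrite (bigD1 (f b)) //= big1 => [|i neq_i].
  by rewrite !mxE eqxx mulr1 addr0 (inj_eq f_inj) addrC subrK.
by rewrite !mxE (negPf neq_i) mulr0.
Qed.

(** An $r$-subset is the image of exactly $r!$ injections. This links the sums over maps used with
    Cauchy-Binet to the sums over subsets in the coefficients. *)
Lemma sum_inj_ffun_imset (V : nmodType) (n r : nat) (D : {set 'I_n} -> V) :
  \sum_(f : {ffun 'I_r -> 'I_n} | injectiveb f) D [set f x | x in 'I_r]
    = (\sum_(S : {set 'I_n} | #|S| == r) D S) *+ r`!.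
Proof.
rewrite (partition_big (fun f : {ffun 'I_r -> 'I_n} => [set f x | x in 'I_r])
  (fun S => #|S| == r)) /=; last first.
  by move=> f /injectiveP finj; rewrite card_imset // card_ord.
rewrite -sumrMnl; apply: eq_bigr => S /eqP cardS.
rewrite (eq_bigr (fun=> D S)); last by move=> f /andP[_ /eqP->].
rewrite sumr_const; congr (_ *+ _).
have -> : r`! = #|S| ^_ #|'I_r| by rewrite card_ord cardS ffactnn.
rewrite -card_inj_ffuns_on; apply: eq_card => f;
  rewrite !inE andbC unfold_in /= andbC.
case: (injectiveP f) => [f_inj|]; rewrite ?andbF //= andbT.
apply/eqP/ffun_onP => [<- x|fS]; first exact: imset_f.
apply/eqP; rewrite eqEcard card_imset // card_ord cardS leqnn andbT.
by apply/subsetP=> _ /imsetP[x _ ->].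
Qed.

Lemma sum_principal_minors (R : comNzRingType) (n r : nat) (M : 'M[R]_n) :
  \sum_(f : {ffun 'I_r -> 'I_n}) \det (mxsub f f M)
    = (\sum_(S : {set 'I_n} | #|S| == r) \det (principal_mx M S)) *+ r`!.
Proof.
rewrite -sum_inj_ffun_imset (bigID (fun f : {ffun 'I_r -> 'I_n} => injectiveb
  f)) /= addrC.
rewrite big1 ?add0r => [|f]; last exact: det_mxsub_noninj.
by apply: eq_bigr => f /injectiveP f_inj; rewrite det_principal_mx.
Qed.

(** In the Leibniz formula every row supplies either an entry of $-M$ or a diagonal ['X]. Collecting
    by the set [S] of rows of the first kind leaves $(-1)^{|S|}$ times the principal minor on [S],
    at degree $n-|S|$. *)
Lemma coef_char_poly_minors (R : comNzRingType) (n j : nat) (M : 'M[R]_n) :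
  (j <= n)%N ->
  (char_poly M)`_(n - j)
    = (-1) ^+ j * \sum_(S : {set 'I_n} | #|S| == j) \det (principal_mx M S).
Proof.
move=> le_jn.
have -> : char_poly M = \sum_(S : {set 'I_n})
    ((-1) ^+ #|S| * \det (principal_mx M S))%:P * 'X^(n - #|S|).
  rewrite /char_poly /(\det _).
  under eq_bigr => s _.
    under eq_bigr => i _ do rewrite !mxE addrC.
    rewrite bigA_distr big_distrr /=; over.
  rewrite exchange_big; apply: eq_bigr => /= S _.
  rewrite /(\det _) big_distrr /= rmorph_sum big_distrl; apply: eq_bigr => s _.
  transitivity ((-1) ^+ s * ((\prod_(i in S) -1)
      * (\prod_i principal_mx M S i (s i))%:P * \prod_(i in ~: S) 'X)).
    congr (_ * _); rewrite rmorph_prod [\prod_(i in S) _]big_mkcond.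
    rewrite [\prod_(i in ~: S) _]big_mkcond -!big_split.
    apply: eq_bigr => i _ /=; rewrite !inE mxE.
    by case: ifP => _ /=; rewrite ?mulN1r ?mul1r ?mulr1 // rmorph_nat mulr_natl.
  rewrite !prodr_const [#|~: S|]cardsCs setCK card_ord !rmorphM /= !rmorph_sign
    /=.
  by rewrite !mulrA [X in X * _ * _]mulrC.
rewrite coef_sum (bigID (fun S : {set 'I_n} => #|S| == j))
  /= addrC big1 ?add0r; last first.
  move=> S neqSj; rewrite coefCM coefXn.
  have leS : (#|S| <= n)%N by rewrite -[n in (_ <= n)%N]card_ord max_card.
  by rewrite eqn_sub2lE // eq_sym (negPf neqSj) mulr0.
rewrite big_distrr; apply: eq_bigr => S /eqP cardS.
by rewrite coefCM coefXn cardS eqxx mulr1.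
Qed.

Lemma charcoef_minors (R : realType) (n j : nat) (M : 'M[R]_n) :
  (j <= n)%N ->
  \sum_(f : {ffun 'I_j -> 'I_n}) \det (mxsub f f M)
    = j`!%:R * (-1) ^+ j * charcoef M j.
Proof.
move=> le_jn; rewrite sum_principal_minors /charcoef coef_char_poly_minors //.
by rewrite -mulrA signrMK mulr_natl.
Qed.

(** * Second order expansion and sums of squared minors *)

Lemma ler_sum_inj (R : numDomainType) (I J : finType) (P : pred I) (Q : pred J)
    (h : I -> J) (F : J -> R) :
  {in P &, injective h} -> (forall i, P i -> Q (h i)) ->
  (forall j, 0 <= F j) ->
  \sum_(i | P i) F (h i) <= \sum_(j | Q j) F j.
Proof.
move=> h_inj PQ F_ge0; rewrite -(big_imset F h_inj) /=.
rewrite [leRHS](bigID [in [set h x | x in P]]) /=.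
rewrite (eq_bigl [pred j | Q j & j \in [set h x | x in P]]); last first.
  move=> j /=; case: imsetP => [[i Pi ->]|]; rewrite ?andbF //.
  by rewrite PQ.
by rewrite lerDl sumr_ge0.
Qed.

(** Cauchy-Schwarz by Lagrange's identity: the double sum of the squares of $a_ib_j-a_jb_i$ is twice
    the difference of the two sides. *)
Lemma sum_mul_sqr_le (R : realDomainType) (I : finType) (P : pred I)
    (a b : I -> R) :
  (\sum_(i | P i) a i * b i) ^+ 2
    <= (\sum_(i | P i) a i ^+ 2) * (\sum_(i | P i) b i ^+ 2).
Proof.
have : 0 <= \sum_(i | P i) \sum_(j | P j) (a i * b j - a j * b i) ^+ 2.
  by apply: sumr_ge0 => i _; apply: sumr_ge0 => j _; apply: sqr_ge0.
have sqrE i j : (a i * b j - a j * b i) ^+ 2 = a i ^+ 2 * b j ^+ 2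
    + b i ^+ 2 * a j ^+ 2 - 2 * (a i * b i) * (a j * b j) by ring.
under eq_bigr => i _.
  under eq_bigr => j _ do rewrite sqrE.
  rewrite sumrB big_split /= -!big_distrr /=; over.
rewrite sumrB big_split /= -!big_distrl /= -big_distrr /=; nra.
Qed.

(** Expand over the set [J] of factors from which [e] is taken. The empty set and the singletons
    give the subtracted terms; each of the remaining at most $2^{|I|}$ sets contributes at most
    $M^{|I|}u^{|J|}\le M^{|I|}u^2$. *)
Lemma prodD_second_order (R : realDomainType) (I : finType) (x e : I -> R)
    (M u : R) :
  1 <= M -> 0 <= u <= 1 ->
  (forall i, `|x i| <= M) -> (forall i, `|e i| <= M * u) ->
  `|\prod_i (x i + e i) - \prod_i x i - \sum_p e p * \prod_(i | i != p) x i|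
    <= 2 ^+ #|I| * M ^+ #|I| * u ^+ 2.
Proof.
move=> M_ge1 /andP[u_ge0 u_le1] xM eM.
have M_ge0 : 0 <= M := le_trans ler01 M_ge1.
under eq_bigr do rewrite addrC.
rewrite bigA_distr /=.
pose T (J : {set I}) := \prod_i (if i \in J then e i else x i).
have T1 : \sum_(J : {set I} | (#|J| != 0%N) && (#|J| == 1%N)) T J
    = \sum_p e p * \prod_(i | i != p) x i.
  rewrite (reindex_omap (fun p : I => [set p]) (fun J => [pick p in J])) /=;
    last first.
    move=> J /andP[_ /cards1P[p ->]]; case: pickP => [q /= | /(_ p)].
      by rewrite inE => /eqP->.
    by rewrite inE eqxx.
  apply: eq_big => p => [|_].
    rewrite cards1 /=; case: pickP => [q /= | /(_ p)]; last by rewrite inE eqxx.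
    by rewrite inE => /eqP->; rewrite eqxx.
  rewrite /T (bigD1 p) //= inE eqxx; congr (_ * _).
  by apply: eq_bigr => i /negPf; rewrite inE => ->.
rewrite (bigID (fun J : {set I} => #|J| == 0%N)) /=.
rewrite (big_pred1 set0) => [|J]; last by rewrite cards_eq0.
rewrite (bigID (fun J : {set I} => #|J| == 1%N)) /= T1.
have -> : \prod_i (if i \in set0 then e i else x i) = \prod_i x i.
  by apply: eq_bigr => i _; rewrite inE.
have subKD (a b c : R) : a + (b + c) - a - b = c by ring.
rewrite subKD.
apply: le_trans (ler_norm_sum _ _ _) _.
have le_T (J : {set I}) : (#|J| != 0%N) && (#|J| != 1%N) ->
    `|T J| <= M ^+ #|I| * u ^+ 2.
  move=> cardJ; rewrite normr_prod.
  apply: le_trans (_ : \prod_i (M * (if i \in J then u else 1)) <= _).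
    apply: ler_prod => i _; rewrite normr_ge0 /=; case: ifP => _ //.
    by rewrite mulr1.
  rewrite big_split /= prodr_const -big_mkcond /= prodr_const.
  rewrite cardT -cardE ler_wpM2l ?exprn_ge0 // ler_wiXn2l //.
  by case: #|J| cardJ => [|[|]].
apply: le_trans (ler_sum _ (fun J cJ => le_T J cJ)) _.
rewrite sumr_const -[leLHS]mulr_natl -!mulrA ler_wpM2r //.
  by rewrite mulr_ge0 ?exprn_ge0.
rewrite -natrX ler_nat -(cardsT I) -card_powerset.
by apply: leq_trans (max_card _) _; rewrite powersetT cardsT.
Qed.

(** Both sides are the determinant of [B] with row [p] replaced by that of [E]: once expanded along
    this row, once by the Leibniz formula. *)
Lemma sum_cofactor_det (R : comNzRingType) (r : nat) (B E : 'M[R]_r) (p : 'I_r)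
  :
  \sum_q E p q * cofactor B p q
    = \sum_(s : 'S_r) (-1) ^+ s * (E p (s p) * \prod_(i | i != p) B i (s i)).
Proof.
pose B' := \matrix_(i, q) if i == p then E i q else B i q.
transitivity (\det B').
  rewrite (expand_det_row _ p); apply: eq_bigr => q _; rewrite !mxE eqxx.
  congr (_ * (_ * \det _)); apply/matrixP=> i q'.
  by rewrite !mxE eq_sym (negPf (neq_lift _ _)).
apply: eq_bigr => s _; congr (_ * _); rewrite (bigD1 p) //= mxE eqxx.
by congr (_ * _); apply: eq_bigr => i /negPf ne_ip; rewrite mxE ne_ip.
Qed.

(** The product estimate is applied to each of the $r!$ Leibniz terms; the cofactor sum is the
    derivative of the determinant in direction [E]. *)
Lemma detD_second_order (R : realDomainType) (r : nat) (B E : 'M[R]_r)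
    (M u : R) :
  1 <= M -> 0 <= u <= 1 ->
  (forall i q, `|B i q| <= M) -> (forall i q, `|E i q| <= M * u) ->
  `|\det (B + E) - \det B - \sum_p \sum_q E p q * cofactor B p q|
    <= r`!%:R * (2 ^+ r * M ^+ r * u ^+ 2).
Proof.
move=> M_ge1 u01 BM EM.
under eq_bigr do rewrite sum_cofactor_det.
rewrite exchange_big /= /(\det _) -!sumrB.
apply: le_trans (ler_norm_sum _ _ _) _.
rewrite -[in leRHS](card_Sn r) mulr_natl -sumr_const; apply: ler_sum => s _.
rewrite -big_distrr /= -!mulrBr normrM normrX normrN1 expr1n mul1r.
under [X in X - _ - _]eq_bigr do rewrite mxE.
rewrite -[in leRHS](card_ord r).
exact: (@prodD_second_order _ _ (fun i => B i (s i)) (fun i => E i (s i))).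
Qed.

(** Deleting row [p] and column [q] of [mxsub f f H] leaves the rows [ffun_drop p f] and columns
    [ffun_drop q f] of [H], so cofactors become minors of [H]. *)
Definition ffun_drop (n r : nat) (p : 'I_r.+1) (f : {ffun 'I_r.+1 -> 'I_n}) :
  {ffun 'I_r -> 'I_n} := [ffun x => f (lift p x)].

Lemma ffun_drop_inj (n r : nat) (p : 'I_r.+1) (f : {ffun 'I_r.+1 -> 'I_n}) :
  injective f -> injective (ffun_drop p f).
Proof. by move=> f_inj x y; rewrite !ffunE => /f_inj/lift_inj. Qed.

(** By symmetry of [F], the left side sums [F] over all rearrangements of all the maps
    [ffun_drop q f]. These are pairwise distinct: the missing value [f q] determines [q], and then
    the permutation. *)
Lemma sum_ffun_drop_perm_le (R : numDomainType) (n r : nat)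
    (f : {ffun 'I_r.+1 -> 'I_n}) (F : {ffun 'I_r -> 'I_n} -> R) :
  injective f -> (forall g, 0 <= F g) ->
  (forall (g : {ffun 'I_r -> 'I_n}) (t : 'S_r), F [ffun x => g (t x)] = F g) ->
  r`!%:R * \sum_q F (ffun_drop q f) <= \sum_g F g.
Proof.
move=> f_inj F_ge0 F_perm.
pose h (qt : 'I_r.+1 * 'S_r) := [ffun x => ffun_drop qt.1 f (qt.2 x)].
have -> : r`!%:R * \sum_q F (ffun_drop q f) = \sum_qt F (h qt).
  rewrite big_distrr -(pair_bigA _ (fun q t => F (h (q, t)))) /=.
  apply: eq_bigr => q _.
  rewrite (eq_bigr (fun=> F (ffun_drop q f))) => [|t _]; last exact: F_perm.
  by rewrite sumr_const card_Sn mulr_natl.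
apply: ler_sum_inj => // -[q t] [q' t'] _ _ /ffunP eq_h.
have eq_lift x : lift q (t x) = lift q' (t' x).
  by have := eq_h x; rewrite !ffunE => /f_inj.
have eq_q : q = q'.
  (* Otherwise [q'] would be some [lift q x], and by [eq_lift] also a value of [lift q'], which
     avoids [q']. *)
  apply/eqP/negPn/negP => ne_qq'; have [x def_q' | nq] := unliftP q q'.
    have := eq_lift ((t^-1)%g x); rewrite permKV -def_q' => /eqP.
    by rewrite (negPf (neq_lift _ _)).
  by rewrite nq eqxx in ne_qq'.
rewrite -{q' eq_h}eq_q in eq_lift *; congr (_, _); apply/permP=> x.
exact: lift_inj (eq_lift x).
Qed.

(** An injective [f] is determined by [ffun_drop p f] and [f p], and the latter must be one of the
    $n-r$ values that the former avoids. *)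
Lemma sum_inj_ffun_drop_le (R : numDomainType) (n r : nat) (p : 'I_r.+1)
    (F : {ffun 'I_r -> 'I_n} -> R) :
  (forall g, 0 <= F g) ->
  \sum_(f : {ffun 'I_r.+1 -> 'I_n} | injectiveb f) F (ffun_drop p f)
    <= (n - r)%:R * \sum_g F g.
Proof.
move=> F_ge0.
pose Q (gx : {ffun 'I_r -> 'I_n} * 'I_n) :=
  injectiveb gx.1 && (gx.2 \notin [set gx.1 x | x in 'I_r]).
apply: le_trans (_ : \sum_(gx | Q gx) F gx.1 <= _).
  apply: (@ler_sum_inj _ _ _ _ Q (fun f => (ffun_drop p f, f p))
      (fun gx => F gx.1)) => // [f f' _ _ [/ffunP eq_f eq_fp] | f /injectiveP
        f_inj].
    apply/ffunP=> x; have [y -> | -> //] := unliftP p x.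
    by have := eq_f y; rewrite !ffunE.
  rewrite /Q /=; apply/andP; split; first exact/injectiveP/ffun_drop_inj.
  apply/imsetP=> -[x _]; rewrite ffunE => /f_inj /eqP.
  by rewrite (negPf (neq_lift _ _)).
rewrite -(pair_big_dep (fun g : {ffun 'I_r -> 'I_n} => injectiveb g)
  (fun g x => x \notin [set g x | x in 'I_r]) (fun g _ => F g)) /=.
rewrite big_distrr [leRHS](bigID (fun g : {ffun 'I_r -> 'I_n} => injectiveb g)).
apply: ler_wpDr; first by apply: sumr_ge0 => g _; rewrite mulr_ge0.
apply: ler_sum => g /injectiveP g_inj; rewrite sumr_const /= mulr_natl.
apply: ler_wpMn2l => //.
have <- : #|~: [set g x | x in 'I_r]| = (n - r)%N.
  by rewrite cardsCs setCK card_imset // !card_ord.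
by apply: eq_leq; apply: eq_card => x; rewrite !inE.
Qed.

(** For the columns, the sum over [q] costs a factor $1/r!$; for the rows, the sum over [f] costs
    $n-r$, for each of $r+1$ choices of [p]. The sum over all pairs of maps is $(r!)^2$ times the
    sum over [S]. *)
Lemma sum_sqr_drop_minors_le (R : realDomainType) (n r : nat) (M : 'M[R]_n) :
  \sum_(f : {ffun 'I_r.+1 -> 'I_n} | injectiveb f) \sum_p \sum_q
      \det (mxsub (ffun_drop p f) (ffun_drop q f) M) ^+ 2
    <= (r.+1`! * (n - r))%:R
       * \sum_(S : {set 'I_n} | #|S| == r) \det (principal_mx (M^T *m M) S).
Proof.
pose phi (g h : {ffun 'I_r -> 'I_n}) := \det (mxsub g h M) ^+ 2.
have phi_ge0 g h : 0 <= phi g h by apply: sqr_ge0.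
have phi_perm g (h : {ffun 'I_r -> 'I_n}) (t : 'S_r) : phi g [ffun x => h (t
  x)] = phi g h.
  rewrite /phi mxsub_ffunr (det_mxsub_permr M g h t) exprMn -exprM mulnC.
  by rewrite exprM sqrrN !expr1n mul1r.
have r_gt0 : 0 < r`!%:R :> R by rewrite ltr0n fact_gt0.
rewrite -(ler_pM2l r_gt0).
apply: le_trans (_ : \sum_(f : {ffun 'I_r.+1 -> 'I_n} | injectiveb f)
    \sum_p \sum_h phi (ffun_drop p f) h <= _).
  rewrite big_distrr; apply: ler_sum => f /injectiveP f_inj /=.
  by rewrite big_distrr; apply: ler_sum => p _; exact: sum_ffun_drop_perm_le.
rewrite exchange_big /=.
apply: le_trans (_ : \sum_(p < r.+1) (n - r)%:R * \sum_g \sum_h phi g h <= _).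
  apply: ler_sum => p _.
  apply: (sum_inj_ffun_drop_le p (F := fun g => \sum_h phi g h)) => g.
  exact: sumr_ge0.
rewrite sumr_const card_ord sum_sqr_minors sum_principal_minors.
set e := \sum_(S | _) _; rewrite factS !natrM -[e *+ _]mulr_natl.
rewrite -[X in X <= _]mulr_natl le_eqVlt.
move: r.+1%:R (n - r)%:R r`!%:R e => a b c d.
by apply/orP; left; apply/eqP; ring.
Qed.

(** * Perturbation bound in terms of singular values *)

(** The generating polynomial makes the recursion in [m] a multiplication by one linear factor. *)
Lemma elem_symE (R : realType) (n : nat) (tau : 'I_n -> R) (r m : nat) :
  elem_sym tau r m = (\prod_(i < n | (i < m)%N) ((tau i)%:P * 'X + 1))`_r.
Proof.
rewrite big_mkcond /=.
(* Factors with $i\ge m$ are written as $0+1$, so that the expansion runs over all subsets of ['I_n]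
   and those leaving the first [m] indices vanish. *)
rewrite (eq_bigr (fun i : 'I_n =>
  (if (i < m)%N then (tau i)%:P * 'X else 0) + 1)); last first.
  by move=> i _; case: ifP => _; rewrite ?add0r.
rewrite bigA_distr /= coef_sum (bigID (fun S : {set 'I_n} =>
  (#|S| == r) && (S \subset [set i : 'I_n | (i < m)%N]))) /=.
rewrite [X in _ + X]big1 ?addr0.
  apply: eq_bigr => S /andP[/eqP cardS /subsetP sub_Sm].
  rewrite -big_mkcond /= (eq_bigr (fun i => (tau i)%:P * 'X)) => [|i iS].
    by rewrite big_split prodr_const -rmorph_prod coefCM coefXn cardS eqxx
      mulr1.
  by have := sub_Sm i iS; rewrite inE => ->.
move=> S; have [/subsetP sub_Sm|/subsetPn[i iS nim] _] := boolP (S \subset _).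
  rewrite andbT => /negPf neq_Sr.
  rewrite -big_mkcond /= (eq_bigr (fun i => (tau i)%:P * 'X)) => [|i iS].
    rewrite big_split prodr_const -rmorph_prod coefCM coefXn eq_sym neq_Sr.
    by rewrite mulr0n mulr0.
  by have := sub_Sm i iS; rewrite inE => ->.
by rewrite (bigD1 i) //= iS; rewrite inE in nim;
  rewrite (negPf nim) mul0r coef0.
Qed.

Lemma elem_sym0r (R : realType) (n : nat) (tau : 'I_n -> R) (m : nat) :
  elem_sym tau 0 m = 1.
Proof.
rewrite elem_symE -horner_coef0 horner_prod big1 // => i _.
by rewrite !(hornerE, mulr0, add0r).
Qed.

Lemma elem_symS (R : realType) (n : nat) (tau : 'I_n -> R) (r : nat) (i : 'I_n)
  :
  elem_sym tau r.+1 i.+1 = elem_sym tau r.+1 i + tau i * elem_sym tau r i.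
Proof.
rewrite !elem_symE (bigD1 i) //= (eq_bigl (fun q : 'I_n => (q < i)%N)).
  rewrite mulrDl mul1r coefD addrC; congr (_ + _).
  by rewrite -mulrA coefCM coefXM.
by move=> q; rewrite ltnS ltn_neqAle andbC.
Qed.

Lemma elem_sym_ge0 (R : realType) (n : nat) (tau : 'I_n -> R) (r m : nat) :
  (forall i, 0 <= tau i) -> 0 <= elem_sym tau r m.
Proof.
by move=> tau_ge0; apply: sumr_ge0 => S _; apply: prodr_ge0 => i _.
Qed.

(** By double counting, $(r+1)e_{r+1}$ is the sum over all $r$-subsets of their product times the
    sum of the $m-r$ other numbers, each at least [x]. The proof obtains the bound by induction on
    [m]. *)
Lemma elem_sym_step_ge (R : realType) (n : nat) (tau : 'I_n -> R) (x : R)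
    (r m : nat) :
  0 <= x -> (m <= n)%N -> (forall i : 'I_n, (i < m)%N -> x <= tau i) ->
  (forall i, 0 <= tau i) ->
  (m - r)%:R * x * elem_sym tau r m <= r.+1%:R * elem_sym tau r.+1 m.
Proof.
move=> x_ge0; elim: m r => [|m IHm] r le_mn x_le tau_ge0.
  by rewrite sub0n !mul0r mulr_ge0 ?elem_sym_ge0.
have [lt_mr|le_rm] := ltnP m r.
  rewrite (_ : (m.+1 - r)%N = 0%N) ?mul0r ?mulr_ge0 ?elem_sym_ge0 //.
  by apply/eqP; rewrite subn_eq0.
have IH q := IHm q (ltnW le_mn) (fun i lt_im => x_le i (ltnW lt_im)) tau_ge0.
have x_le_m := x_le (Ordinal le_mn) (ltnSn m).
rewrite (elem_symS tau r (Ordinal le_mn)) /=; set t := tau _ in x_le_m *.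
have t_ge0 : 0 <= t by apply: tau_ge0.
rewrite subSn // -[(m - r).+1]addn1 natrD mulrDl -addn1 [r.+1%:R]mulrS.
have := IH r; have := elem_sym_ge0 r m tau_ge0.
case: r le_rm => [|r] le_rm e_ge0 IHr.
  rewrite !elem_sym0r in e_ge0 IHr *; nra.
rewrite addn1 (elem_symS tau r (Ordinal le_mn)) /= -/t.
have := IH r; have -> : (m - r)%N = (m - r.+1).+1 by rewrite subnSK.
rewrite -[(m - r.+1).+1]addn1 natrD; have := elem_sym_ge0 r m tau_ge0.
set a := (m - r.+1)%:R in IHr *; have a_ge0 : 0 <= a by apply: ler0n.
move=> e'_ge0 IHr'.
(* On the right, $(r+2)te_{r+1}$ is split: $r+1$ copies come from the induction hypothesis at [r],
   the last one from $x\le t$. The hypothesis at $r+1$ covers the part without [t]. *)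
have h1 : t * ((a + 1) * x * elem_sym tau r m)
   <= t * (r.+1%:R * elem_sym tau r.+1 m) by apply: ler_wpM2l.
have h2 : x * elem_sym tau r.+1 m <= t * elem_sym tau r.+1 m.
  exact: ler_wpM2r.
rewrite [r.+2%:R]mulrS in IHr *; lra.
Qed.

(* The average of all products of r of the m largest numbers is nonincreasing
   in m, here with the binomial denominators cleared. *)
Lemma elem_sym_avg_le (R : realType) (n : nat) (tau : 'I_n -> R) (r j m : nat) :
  (r <= j)%N -> (j <= m <= n)%N ->
  (forall i, 0 <= tau i) ->
  (forall i q : 'I_n, (i <= q)%N -> tau q <= tau i) ->
  'C(j, r)%:R * elem_sym tau r m <= 'C(m, r)%:R * elem_sym tau r j.
Proof.
move=> le_rj /andP[le_jm le_mn] tau_ge0 tau_mono.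
elim: m le_jm le_mn => [|m IHm] le_jm le_mn.
  by move: le_jm; rewrite leqn0 => /eqP->.
move: le_jm; rewrite leq_eqVlt => /orP[/eqP-> //|]; rewrite ltnS => le_jm.
have le_rm := leq_trans le_rj le_jm.
case: r le_rj le_rm IHm => [|r] le_rj le_rm IHm.
  by rewrite !elem_sym0r !bin0.
have {}IHm := IHm le_jm (ltnW le_mn).
rewrite (elem_symS tau r (Ordinal le_mn)) /=; set t := tau _.
have t_ge0 : 0 <= t by apply: tau_ge0.
(* [t] is the least of the first $m+1$ numbers, so [step] replaces $te_r$ by $e_{r+1}$. After
   scaling by $m-r$, the coefficients add up to $(m-r)+(r+1)=m+1$, the factor in [binE]. *)
have step : (m - r)%:R * t * elem_sym tau r m <= r.+1%:R * elem_sym tau r.+1 m.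
  by apply: elem_sym_step_ge => // [|i lt_im];
    [exact: ltnW | apply/tau_mono/ltnW].
have binE : (m - r)%:R * 'C(m.+1, r.+1)%:R = m.+1%:R * 'C(m, r.+1)%:R :> R.
  by rewrite -!natrM (mul_bin_down m.+1) subSS.
have mr_gt0 : 0 < (m - r)%:R :> R by rewrite ltr0n subn_gt0.
have mE : m.+1%:R = (m - r)%:R + r.+1%:R :> R.
  by rewrite -natrD addnS subnK // ltnW.
have e_ge0 := elem_sym_ge0 r.+1 j tau_ge0.
rewrite -(ler_pM2l mr_gt0) [leRHS]mulrA binE.
have C_ge0 : 0 <= 'C(j, r.+1)%:R :> R by apply: ler0n.
have h1 : 'C(j, r.+1)%:R * ((m - r)%:R * t * elem_sym tau r m)
   <= 'C(j, r.+1)%:R * (r.+1%:R * elem_sym tau r.+1 m) by apply: ler_wpM2l.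
have h2 : m.+1%:R * ('C(j, r.+1)%:R * elem_sym tau r.+1 m)
   <= m.+1%:R * ('C(m, r.+1)%:R * elem_sym tau r.+1 j) by apply: ler_wpM2l.
rewrite -[leRHS]mulrA; apply: le_trans h2.
rewrite mE; lra.
Qed.

(** These are the diagonal terms of the expanded square, whose other terms are nonnegative. *)
Lemma elem_sym_sqr_le (R : realType) (n : nat) (tau : 'I_n -> R) (r m : nat) :
  (forall i, 0 <= tau i) ->
  elem_sym (fun i => tau i ^+ 2) r m <= elem_sym tau r m ^+ 2.
Proof.
move=> tau_ge0; rewrite expr2 [X in _ <= X * _]/elem_sym big_distrl.
apply: ler_sum => S PS; rewrite prodrXl expr2 ler_wpM2l ?prodr_ge0 //.
rewrite /elem_sym (bigD1 S) //= lerDl sumr_ge0 // => S' _.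
by rewrite prodr_ge0.
Qed.

(** The diagonal matrix of the $\sigma_i^2$ has the same characteristic polynomial as $A^TA$, hence
    the same sums of principal minors, and its own are explicit products. *)
Lemma principal_minors_singular (R : realType) (n r : nat) (A : 'M[R]_n)
    (sigma : 'I_n -> R) :
  (r <= n)%N -> singular_values A sigma ->
  \sum_(S : {set 'I_n} | #|S| == r) \det (principal_mx (A^T *m A) S)
    = elem_sym (fun i => sigma i ^+ 2) r n.
Proof.
move=> le_rn [_ _ char_eq]; pose d : 'rV[R]_n := \row_i (sigma i ^+ 2).
have char_d : char_poly (diag_mx d) = char_poly (A^T *m A).
  rewrite char_eq char_poly_trig.
    by apply: eq_bigr => i _; rewrite !mxE eqxx.
  exact/diag_mx_is_trig.
have := congr1 (fun p : {poly R} => p`_(n - r)) char_d.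
rewrite !coef_char_poly_minors // => /(can_inj (signrMK r)) <-.
apply: eq_big => [S|S _].
  rewrite (_ : S \subset _) ?andbT //.
  by apply/subsetP=> i _; rewrite inE ltn_ord.
have -> : principal_mx (diag_mx d) S
    = diag_mx (\row_i if i \in S then sigma i ^+ 2 else 1).
  apply/matrixP=> i q; rewrite !mxE; case: (i \in S) => //.
rewrite det_diag [RHS]big_mkcond; apply: eq_bigr => i _.
by rewrite mxE.
Qed.

Lemma char_poly_orthogonal (R : realType) (n : nat) (A Q : 'M[R]_n) :
  Q^T *m Q = 1%:M -> char_poly (Q^T *m A *m Q) = char_poly A.
Proof.
move=> QtQ; rewrite /char_poly.
have QtQp : map_mx polyC Q^T *m map_mx polyC Q = 1%:M.
  by rewrite -map_mxM QtQ map_mx1.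
have -> : char_poly_mx (Q^T *m A *m Q)
    = map_mx polyC Q^T *m char_poly_mx A *m map_mx polyC Q.
  rewrite /char_poly_mx mulmxBr mulmxBl -!map_mxM; congr (_ - _).
  by rewrite mul_mx_scalar -scalemxAl QtQp scalemx1.
rewrite !det_mulmx mulrC mulrA -det_mulmx.
by rewrite (mulmx1C QtQp) det1 mul1r.
Qed.

Lemma orthogonally_similar_invariants (R : realType) (n : nat) (A H : 'M[R]_n)
    (sigma : 'I_n -> R) :
  orthogonally_similar H A -> singular_values A sigma ->
  [/\ char_poly H = char_poly A, singular_values H sigma & frob H = frob A].
Proof.
move=> [Q QtQ ->] [sigma_ge0 sigma_mono char_eq].
have HtH : (Q^T *m A *m Q)^T *m (Q^T *m A *m Q) = Q^T *m (A^T *m A) *m Q.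
  rewrite !trmx_mul trmxK !mulmxA; congr (_ *m _ *m _).
  by rewrite -(mulmxA _ Q) (mulmx1C QtQ) mulmx1.
have frobE (B : 'M[R]_n) : frob B = Num.sqrt (\tr (B^T *m B)).
  congr Num.sqrt; rewrite exchange_big; apply: eq_bigr => i _.
  by rewrite mxE; apply: eq_bigr => q _; rewrite mxE expr2.
split; first exact: char_poly_orthogonal.
  by split=> //; rewrite HtH char_poly_orthogonal.
by rewrite !frobE HtH mxtrace_mulC (mulmxA Q) (mulmx1C QtQ) mul1mx.
Qed.

Lemma frob_ge0 (R : realType) (n : nat) (A : 'M[R]_n) : 0 <= frob A.
Proof. exact: sqrtr_ge0. Qed.

Lemma frob_sqr (R : realType) (n : nat) (A : 'M[R]_n) :
  frob A ^+ 2 = \sum_i \sum_j A i j ^+ 2.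
Proof.
rewrite sqr_sqrtr //; apply: sumr_ge0 => i _; apply: sumr_ge0 => j _.
exact: sqr_ge0.
Qed.

Lemma entry_le_frob (R : realType) (n : nat) (A : 'M[R]_n) (i q : 'I_n) :
  `|A i q| <= frob A.
Proof.
rewrite -sqrtr_sqr ler_wsqrtr // (bigD1 i) //= (bigD1 q) //= -addrA lerDl.
rewrite addr_ge0 ?sumr_ge0 // => [x _|x _]; first exact: sqr_ge0.
by apply: sumr_ge0 => y _; apply: sqr_ge0.
Qed.

Lemma sum_inj_frob_le (R : realType) (n j : nat) (E : 'M[R]_n) :
  \sum_(f : {ffun 'I_j -> 'I_n} | injectiveb f) \sum_p \sum_q
      E (f p) (f q) ^+ 2
    <= (n ^_ j)%:R * frob E ^+ 2.
Proof.
have -> : (n ^_ j)%:R * frob E ^+ 2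
    = \sum_(f : {ffun 'I_j -> 'I_n} | injectiveb f) frob E ^+ 2.
  rewrite sumr_const -[RHS]mulr_natl; congr (_%:R * _).
  have := card_inj_ffuns 'I_j 'I_n; rewrite !card_ord => <-.
  by apply: eq_card => f; rewrite inE.
apply: ler_sum => f /injectiveP f_inj; rewrite frob_sqr.
apply: le_trans (_ : \sum_p \sum_q E (f p) q ^+ 2 <= _).
  apply: ler_sum => p _.
  apply: (@ler_sum_inj _ _ _ xpredT xpredT f (fun q => E (f p) q ^+ 2)) => //.
    by move=> x y _ _; apply: f_inj.
  by move=> q; apply: sqr_ge0.
apply: (@ler_sum_inj _ _ _ xpredT xpredT f (fun i => \sum_q E i q ^+ 2)) => //.
  by move=> x y _ _; apply: f_inj.
by move=> i; apply: sumr_ge0 => q _; apply: sqr_ge0.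
Qed.

(** Here the sum over all [n] singular values gives way to the $r+1$ largest: the averaging
    inequality is applied to their squares, with $\binom{r+1}{r}=r+1$ and
    $(r+1)\binom{n}{r+1}=(n-r)\binom nr$. *)
Lemma sum_minors_singular_le (R : realType) (n r : nat) (H : 'M[R]_n)
    (sigma : 'I_n -> R) :
  (r < n)%N -> singular_values H sigma ->
  (n - r)%:R * \sum_(S : {set 'I_n} | #|S| == r) \det (principal_mx (H^T *m H)
    S)
    <= 'C(n, r.+1)%:R * elem_sym sigma r r.+1 ^+ 2.
Proof.
move=> lt_rn sv_H; have [sigma_ge0 sigma_mono _] := sv_H.
rewrite (principal_minors_singular (ltnW lt_rn) sv_H).
have r_gt0 : 0 < r.+1%:R :> R by rewrite ltr0n.
rewrite -(ler_pM2l r_gt0) [leRHS]mulrA -natrM mul_bin_left natrM.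
rewrite mulrCA -[leRHS]mulrA ler_wpM2l //.
have := @elem_sym_avg_le _ _ (fun i => sigma i ^+ 2) r r.+1 n (leqnSn r).
rewrite lt_rn leqnn => /(_ isT) avg;
  rewrite -(@bin_sub r.+1 r) // subSnn bin1 in avg.
apply: le_trans (avg _ _) _ => [i|i q le_iq|]; first exact: sqr_ge0.
  by rewrite ler_sqr ?nnegrE ?sigma_mono.
by rewrite ler_wpM2l // elem_sym_sqr_le.
Qed.

(* Cauchy-Schwarz over all triples (f, p, q); the cofactors are, up to sign,
   minors of H of order r. *)
Lemma sum_cofactor_le (R : realType) (n r : nat) (H E : 'M[R]_n)
    (sigma : 'I_n -> R) :
  (r < n)%N -> singular_values H sigma ->
  `|\sum_(f : {ffun 'I_r.+1 -> 'I_n} | injectiveb f) \sum_p \sum_q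
      E (f p) (f q) * cofactor (mxsub f f H) p q|
    <= r.+1`!%:R * ('C(n, r.+1)%:R * elem_sym sigma r r.+1 * frob E).
Proof.
move=> lt_rn sv_H; have [sigma_ge0 sigma_mono _] := sv_H.
have e_ge0 := elem_sym_ge0 r r.+1 sigma_ge0.
have F_ge0 := frob_ge0 E.
rewrite -ler_sqr ?nnegrE ?mulr_ge0 // real_normK ?num_real //.
have tripleE (G : {ffun 'I_r.+1 -> 'I_n} -> 'I_r.+1 -> 'I_r.+1 -> R) :
    \sum_(f : {ffun 'I_r.+1 -> 'I_n} | injectiveb f) \sum_p \sum_q G f p q
      = \sum_(x : {ffun 'I_r.+1 -> 'I_n} * ('I_r.+1 * 'I_r.+1)
                | injectiveb x.1 && true) G x.1 x.2.1 x.2.2.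
  under eq_bigr do rewrite pair_bigA /=.
  by rewrite pair_big.
rewrite (tripleE (fun f p q => E (f p) (f q) * cofactor (mxsub f f H) p q)).
apply: le_trans (sum_mul_sqr_le _ _ _) _.
rewrite -(tripleE (fun f p q => E (f p) (f q) ^+ 2)).
rewrite -(tripleE (fun f p q => cofactor (mxsub f f H) p q ^+ 2)).
have cofE (f : {ffun 'I_r.+1 -> 'I_n}) p q : cofactor (mxsub f f H) p q ^+ 2
    = \det (mxsub (ffun_drop p f) (ffun_drop q f) H) ^+ 2.
  rewrite /cofactor exprMn sqrr_sign mul1r; congr (\det _ ^+ 2).
  by apply/matrixP=> i i'; rewrite !mxE !ffunE.
under [X in _ * X]eq_bigr do
  under eq_bigr do under eq_bigr do rewrite cofE.
have := sum_minors_singular_le lt_rn sv_H; set e := \sum_(S | _) _ => le_e.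
have e'_ge0 : 0 <= (n ^_ r.+1)%:R * frob E ^+ 2 by rewrite mulr_ge0 ?exprn_ge0.
apply: le_trans (ler_pM _ _ (sum_inj_frob_le _ E) (sum_sqr_drop_minors_le r H))
  _.
- by do 3![apply: sumr_ge0 => ? _]; apply: sqr_ge0.
- by do 3![apply: sumr_ge0 => ? _]; apply: sqr_ge0.
rewrite -/e natrM -[X in _ * X]mulrA.
apply: le_trans (_ : _ <= (n ^_ r.+1)%:R * frob E ^+ 2 * (r.+1`!%:R *
   ('C(n, r.+1)%:R * elem_sym sigma r r.+1 ^+ 2))) _.
  by rewrite !ler_wpM2l.
(* Since $n(n-1)\cdots(n-r)=\binom{n}{r+1}(r+1)!$, the product of the two bounds is a perfect
   square. *)
rewrite -bin_ffact natrM.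
move: ('C(n, r.+1))%:R r.+1`!%:R (frob E) (elem_sym _ _ _) => a b c d.
by rewrite le_eqVlt; apply/orP; left; apply/eqP; ring.
Qed.

(** After scaling by $(r+1)!$ both coefficients are sums of determinants over maps [f], each
    expanded to second order. Non-injective maps give zero determinants and are discarded before the
    expansion. *)
Lemma charcoefD_le (R : realType) (n r : nat) (H E : 'M[R]_n)
    (sigma : 'I_n -> R) (M u : R) :
  (r < n)%N -> singular_values H sigma -> 1 <= M -> 0 <= u <= 1 ->
  frob H <= M -> frob E <= M * u ->
  `|charcoef (H + E) r.+1 - charcoef H r.+1|
    <= 'C(n, r.+1)%:R * elem_sym sigma r r.+1 * frob E
       + (2 * M * n%:R) ^+ r.+1 * u ^+ 2.
Proof.
move=> lt_rn sv_H M_ge1 u01 HM EM.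
have M_ge0 : 0 <= M := le_trans ler01 M_ge1.
have fact_gt0R : 0 < r.+1`!%:R :> R by rewrite ltr0n fact_gt0.
rewrite -(ler_pM2l fact_gt0R) mulrDr.
have -> : r.+1`!%:R * `|charcoef (H + E) r.+1 - charcoef H r.+1|
    = `|r.+1`!%:R * (-1) ^+ r.+1 * charcoef (H + E) r.+1
       - r.+1`!%:R * (-1) ^+ r.+1 * charcoef H r.+1|.
  rewrite -mulrBr !normrM normrX normrN1 expr1n mulr1.
  by rewrite (gtr0_norm fact_gt0R).
rewrite -!charcoef_minors //.
pose L := \sum_(f : {ffun 'I_r.+1 -> 'I_n} | injectiveb f) \sum_p \sum_q
  E (f p) (f q) * cofactor (mxsub f f H) p q.
rewrite -[X in `|X|](subrK L) addrC.
apply: le_trans (ler_normD _ _) (lerD (sum_cofactor_le E lt_rn sv_H) _).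
rewrite -sumrB (bigID (fun f : {ffun 'I_r.+1 -> 'I_n} => injectiveb f)) /=.
rewrite [X in _ + X - _]big1 ?addr0 => [|f ninj]; last first.
  by rewrite !det_mxsub_noninj // subrr.
rewrite -sumrB; apply: le_trans (ler_norm_sum _ _ _) _.
(* Bounding the remainder over all $n^{r+1}$ maps yields the closed form $(2Mn)^{r+1}$. *)
apply: le_trans (_ : \sum_(f : {ffun 'I_r.+1 -> 'I_n})
  r.+1`!%:R * (2 ^+ r.+1 * M ^+ r.+1 * u ^+ 2) <= _).
  rewrite [leRHS](bigID (fun f : {ffun 'I_r.+1 -> 'I_n} => injectiveb f)) /=.
  apply: ler_wpDr.
    by apply: sumr_ge0 => f _; rewrite !mulr_ge0 ?exprn_ge0 //; case/andP: u01.
  apply: ler_sum => f _.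
  have -> : mxsub f f (H + E) = mxsub f f H + mxsub f f E.
    by apply/matrixP=> p q; rewrite !mxE.
  rewrite (eq_bigr (fun p => \sum_q mxsub f f E p q
      * cofactor (mxsub f f H) p q)) => [|p _]; last first.
    by apply: eq_bigr => q _; rewrite [mxsub f f E p q]mxE.
  apply: detD_second_order => // p q; rewrite mxE.
    exact: le_trans (entry_le_frob _ _ _) HM.
  exact: le_trans (entry_le_frob _ _ _) EM.
rewrite sumr_const card_ffun !card_ord -[leLHS]mulr_natl natrX !exprMn.
by rewrite le_eqVlt; apply/orP; left; apply/eqP; ring.
Qed.

(** * Characteristic polynomials of Hessenberg matrices *)

(** The last row has only two entries that can be nonzero. Deleting it with the last but one column
    leaves a matrix of the same shape; the arbitrary last column [v] is what makes the induction
    close. *)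
Lemma hessenberg_det_col (K : comNzRingType) (a : nat -> nat -> K)
    (v : nat -> K) (i : nat) :
  (forall p q, (q.+1 < p)%N -> a p q = 0) ->
  \det (\matrix_(p < i.+1, q < i.+1) if q == i :> nat then v p else a p q)
    = \sum_(m < i.+1) v (i - m)%N * (\prod_(t < m) - a (i - t)%N (i - t).-1)
        * \det (\matrix_(p < i - m, q < i - m) a p q).
Proof.
move=> a0; elim: i => [|i IHi].
  by rewrite big_ord1 !det_mx00 det_mx11 mxE eqxx big_ord0 !mulr1.
rewrite (expand_det_row _ ord_max) big_ord_recr /= mxE eqxx.
rewrite big_ord_recr /= big1 => [|q _]; last first.
  rewrite mxE /= ltn_eqF ?a0 ?mul0r //; first by rewrite ltnS ltn_ord.
  by rewrite ltnS ltnW // ltn_ord.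
rewrite add0r [RHS]big_ord_recl /= big_ord0 subn0 mulr1 addrC; congr (_ + _).
  congr (_ * _); rewrite /cofactor /= -signr_odd oddD addbb mul1r;
    congr (\det _).
  apply/matrixP=> p q; rewrite !mxE !lift_max.
  by rewrite ltn_eqF.
rewrite mxE /= ltn_eqF // /cofactor /=.
(* Removing column [i] moves the column [v] from position $i+1$ to position [i]. *)
set B := row' _ _; have -> : \det B
    = \det (\matrix_(p < i.+1, q < i.+1) if q == i :> nat then v p else a p q).
  congr (\det _); apply/matrixP=> p q; rewrite !mxE lift_max /= /bump.
  have [->|ne_qi] := eqVneq (q : nat) i; first by rewrite leqnn eqxx.
  have lt_qi : (q < i)%N by rewrite ltn_neqAle ne_qi -ltnS ltn_ord.
  by rewrite [(i <= q)%N]leqNgt lt_qi add0n ltn_eqF // ltnW.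
rewrite IHi addSn -signr_odd /= oddD addbb /= expr1 mulN1r mulrN -mulNr.
rewrite big_distrr; apply: eq_bigr => m _; rewrite /= /bump add1n subSS.
rewrite big_ord_recl /= subn0 /= !mulrA; congr (_ * _).
by rewrite [- _ * v _]mulrC -!mulrA; congr (_ * (_ * _)).
Qed.

Lemma hessenberg_det (K : comNzRingType) (a : nat -> nat -> K) (i : nat) :
  (forall p q, (q.+1 < p)%N -> a p q = 0) ->
  \det (\matrix_(p < i.+1, q < i.+1) a p q)
    = \sum_(m < i.+1) a (i - m)%N i * (\prod_(t < m) - a (i - t)%N (i - t).-1)
        * \det (\matrix_(p < i - m, q < i - m) a p q).
Proof.
move=> a0; rewrite -(hessenberg_det_col (fun p => a p i)) //.
congr (\det _); apply/matrixP=> p q; rewrite !mxE.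
by case: eqP => // ->.
Qed.

Definition leading_char_poly (R : realType) (n : nat) (Ht : 'M[R]_n) (i : nat) :
    {poly R} :=
  char_poly (\matrix_(p < i, q < i) entry Ht p.+1 q.+1).

Lemma leading_char_poly_full (R : realType) (n : nat) (Ht : 'M[R]_n) :
  leading_char_poly Ht n = char_poly Ht.
Proof.
congr char_poly; apply/matrixP=> p q; rewrite mxE /entry /=.
by rewrite !insubT //= => ltp ltq; congr (Ht _ _); apply: val_inj.
Qed.

Lemma entry_hessenberg (R : realType) (n : nat) (Ht : 'M[R]_n) (p q : nat) :
  upper_hessenberg Ht -> (q.+1 < p)%N -> entry Ht p.+1 q.+1 = 0.
Proof.
move=> Ht_hess lt_qp; rewrite /entry /=; case: insubP => // p' _ def_p.
by case: insubP => // q' _ def_q; apply: Ht_hess; rewrite def_p def_q.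
Qed.

(** The expansion is applied to $\lambda I-\tilde H$: $m=0$ gives the diagonal factor; for $m\ge1$
    the subdiagonal signs cancel and $-h_{i-m,i}$ leaves one minus sign. *)
Lemma leading_char_polyS (R : realType) (n : nat) (Ht : 'M[R]_n) (i : nat) :
  upper_hessenberg Ht ->
  leading_char_poly Ht i.+1 = ('X - (entry Ht i.+1 i.+1)%:P) *
    leading_char_poly Ht i
    - \sum_(1 <= m < i.+1) (b_elt Ht i.+1 m)%:P * leading_char_poly Ht (i - m).
Proof.
move=> Ht_hess.
pose a p q : {poly R} := 'X *+ (p == q) - (entry Ht p.+1 q.+1)%:P.
have leadE r : leading_char_poly Ht r = \det (\matrix_(p < r, q < r) a p q).
  by congr (\det _); apply/matrixP=> p q; rewrite !mxE.
rewrite leadE hessenberg_det => [|p q lt_qp]; last first.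
  rewrite /a entry_hessenberg // polyC0 subr0.
  by rewrite gtn_eqF // ltnW.
rewrite big_ord_recl /= subn0 big_ord0 mulr1 -leadE /a eqxx; congr (_ + _).
rewrite big_add1 big_mkord -sumrN; apply: eq_bigr => m _.
rewrite -leadE /bump /= add1n -mulNr; congr (_ * _).
rewrite ltn_eqF; last by rewrite -subn_gt0 subKn // ltn_ord.
rewrite sub0r /b_elt big_cons rmorphM mulNr; congr (- (_%:P * _)).
  by rewrite subSS subnSK ?ltn_ord.
rewrite big_map rmorph_prod [in RHS](_ : iota 0 m.+1 = index_iota 0 m.+1);
  last by rewrite /index_iota subn0.
rewrite big_mkord.
apply: eq_bigr => t _ /=.
have lt_ti : (t < i)%N := leq_trans (ltn_ord t) (ltn_ord m).
rewrite subSn ?(ltnW lt_ti) //; have it_gt0 : (0 < i - t)%N by rewrite subn_gt0.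
by rewrite gtn_eqF ?prednK // sub0r opprK.
Qed.

(* The exact counterpart of \hat c_j^{(i)}. *)
Definition leading_charcoef (R : realType) (n : nat) (Ht : 'M[R]_n) (j i : nat)
  :
  R := (leading_char_poly Ht i)`_(i - j).

Lemma leading_charcoef0 (R : realType) (n : nat) (Ht : 'M[R]_n) (i : nat) :
  leading_charcoef Ht 0 i = 1.
Proof.
rewrite /leading_charcoef subn0; have /monicP := char_poly_monic
  (\matrix_(p < i, q < i) entry Ht p.+1 q.+1).
by rewrite lead_coefE size_char_poly.
Qed.

(** Coefficients of degree $i-j$ are compared. The case [j == i] is set to 0 by hand, since
    truncated subtraction would return a constant coefficient there. *)
Lemma leading_charcoefE (R : realType) (n : nat) (Ht : 'M[R]_n) (j i : nat) :
  upper_hessenberg Ht -> (1 <= j <= i)%N ->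
  leading_charcoef Ht j i
    = (if j == i then 0 else leading_charcoef Ht j i.-1)
      - entry Ht i i * leading_charcoef Ht j.-1 i.-1
      - \sum_(1 <= m < j) b_elt Ht i m * leading_charcoef Ht (j - m - 1) (i - m
        - 1).
Proof.
move=> Ht_hess; case: j i => [|j] [|i] //=; rewrite ltnS => le_ji.
rewrite /leading_charcoef leading_char_polyS // coefB mulrBl coefB coefXM
  coefCM.
rewrite subSS; congr (_ - _ * _ - _).
  rewrite subn_eq0 eqSS; have [le_ij|lt_ji] := leqP i j.
    by rewrite (_ : j == i) // eqn_leq le_ji.
  by rewrite ltn_eqF // -subnS.
(* For $m>j$ the degree $i-m$ is below the coefficient index $i-j$. *)
rewrite coef_sum (big_cat_nat (n := j.+1)) //= [X in _ + X]big_nat.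
rewrite [X in _ + X]big1 ?addr0 => [|m /andP[lt_jm lt_mi]]; last first.
  rewrite coefCM nth_default ?mulr0 // size_char_poly.
  by rewrite ltn_sub2l // (leq_trans lt_jm).
apply: eq_big_nat => m /andP[_]; rewrite ltnS => le_mj; rewrite coefCM.
have subE x : (x.+1 - m - 1 = x - m)%N by rewrite subnAC subn1.
by rewrite !subE subnBA // subnK // (leq_trans _ le_ji).
Qed.

Lemma charcoef_leading (R : realType) (n : nat) (Ht : 'M[R]_n) (j : nat) :
  charcoef Ht j = leading_charcoef Ht j n.
Proof. by rewrite /leading_charcoef leading_char_poly_full. Qed.

(** * Rounding errors *)

Lemma fp_op_num_err (R : realType) (u : R) (F : fp_arith u) (o : fop) (x y : R)
  :
  fp_num F x -> fp_num F y -> fp_safe F o x y ->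
  fp_num F (fp_op F o x y)
  /\ `|fp_op F o x y - exact_op o x y| <= u * `|exact_op o x y|.
Proof.
move=> Fx Fy safe; split; first exact: fp_num_op.
have [d le_d ->] := fp_op_mulE Fx Fy safe.
by rewrite mulrDr mulr1 addrC addKr normrM mulrC ler_wpM2r.
Qed.

(** The division form of the model bounds the error relative to the computed value, which is the
    source of the terms $u|\hat c_j^{(i)}|$ in the running bounds. *)
Lemma fp_op_num_back_err (R : realType) (u : R) (F : fp_arith u) (o : fop)
    (x y : R) :
  u < 1 -> fp_num F x -> fp_num F y -> fp_safe F o x y ->
  fp_num F (fp_op F o x y)
  /\ `|fp_op F o x y - exact_op o x y| <= u * `|fp_op F o x y|.
Proof.
move=> u_lt1 Fx Fy safe; split; first exact: fp_num_op.
have [e le_e ->] := fp_op_divE Fx Fy safe.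
have e1_neq0 : 1 + e != 0.
  apply/eqP=> /addr0_eq def_e; move: le_e.
  by rewrite -def_e normrN1 leNgt u_lt1.
set v := _ / _; have -> : exact_op o x y = v * (1 + e) by rewrite divfK.
by rewrite mulrDr mulr1 opprD addrA subrr add0r normrN normrM mulrC ler_wpM2r.
Qed.

(* Bounds the relative error accumulated by m successive roundings. *)
Definition accum (R : realType) (u : R) (m : nat) : R := (1 + u) ^+ m - 1.

Lemma accum_ge0 (R : realType) (u : R) (m : nat) : 0 <= u -> 0 <= accum u m.
Proof. by move=> u_ge0; rewrite subr_ge0 exprn_ege1 // lerDl. Qed.

Lemma accumS (R : realType) (u : R) (m : nat) :
  accum u m.+1 = (1 + u) * accum u m + u.
Proof. by rewrite /accum exprS; ring. Qed.

Lemma accum_le_gam (R : realType) (u : R) (m : nat) :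
  0 <= u -> m%:R * u < 1 -> accum u m <= gam u m.
Proof.
move=> u_ge0 mu_lt1; have mu_gt0 : 0 < 1 - m%:R * u by rewrite subr_gt0.
rewrite /accum /gam ler_pdivlMr // mulrBl mul1r lerBlDr [leRHS]addrC subrK.
(* The claim is now $(1+u)^m(1-mu)\le1$; it is inductive because $(1+u)(1-(m+1)u)\le1-mu$. *)
elim: m {mu_lt1 mu_gt0} => [|m IHm]; first by rewrite mul0r subr0 mulr1.
apply: le_trans IHm; rewrite exprSr -mulrA ler_wpM2l ?exprn_ge0 ?addr_ge0 //.
have : 0 <= m%:R * u ^+ 2 by rewrite mulr_ge0 // sqr_ge0.
have : 0 <= u ^+ 2 by apply: sqr_ge0.
rewrite mulrS !expr2; lra.
Qed.

Lemma fl_chain_mul_err (R : realType) (u : R) (F : fp_arith u) (x : R)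
    (t : seq R) :
  0 <= u -> {in x :: t, forall y, fp_num F y} ->
  flsafe F (chain Mul (map (@Lit R) (x :: t))) ->
  let v := flval F (chain Mul (map (@Lit R) (x :: t))) in
  let p := \prod_(y <- x :: t) y in
  fp_num F v /\ `|v - p| <= accum u (size t) * `|p|.
Proof.
move=> u_ge0; elim/last_ind: t => [|t y IHt] num_t /=.
  rewrite big_seq1 => _; split; first by apply: num_t; rewrite inE.
  by rewrite subrr normr0 mulr_ge0 ?accum_ge0.
rewrite map_rcons foldl_rcons /= => -[safe_t _ safe].
have [|num_v le_v] := IHt _ safe_t.
  by move=> z z_t; apply: num_t; rewrite -rcons_cons mem_rcons inE z_t orbT.
have num_y : fp_num F y.
  by apply: num_t; rewrite -rcons_cons mem_rcons mem_head.
have [num_vy le_vy] := fp_op_num_err num_v num_y safe; split=> //.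
rewrite -rcons_cons -cats1 big_cat big_seq1 size_rcons accumS.
move: le_v le_vy; rewrite /=; set p := \prod_(_ <- _) _.
set v := flval _ _; move: (fp_op _ _ _ _) => v' le_v le_vy.
apply: le_trans (ler_distD (v * y) _ _) _; rewrite -mulrBl !normrM in le_vy *.
have v_le : `|v| <= `|p| + `|v - p|.
  by rewrite -[v in leLHS](subrK p) addrC ler_normD.
have y_ge0 := normr_ge0 y.
have h1 : u * (`|v| * `|y|) <= u * ((`|p| + accum u (size t) * `|p|) * `|y|).
  by rewrite ler_wpM2l // ler_wpM2r // (le_trans v_le) // lerD2l.
have h2 : `|v - p| * `|y| <= accum u (size t) * `|p| * `|y| by rewrite
  ler_wpM2r.
apply: le_trans (lerD (le_trans le_vy h1) h2) _.
by rewrite le_eqVlt; apply/orP; left; apply/eqP; ring.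
Qed.

(** A summand undergoes one rounding per multiplication in its product and one per addition from its
    entry on: [size ts] additions for the first summand, [size ts - l] for entry [l] of [ts]. *)
Lemma fl_chain_add_err (R : realType) (u : R) (F : fp_arith u) (t0 : seq R)
    (ts : seq (seq R)) :
  0 <= u ->
  {in t0 :: ts, forall t, t != [::]
     /\ {in t, forall y, fp_num F y}} ->
  let e := chain Add [seq chain Mul (map (@Lit R) t) | t <- t0 :: ts] in
  let p (t : seq R) := \prod_(y <- t) y in
  flsafe F e ->
  fp_num F (flval F e)
  /\ `|flval F e - (p t0 + \sum_(l < size ts) p (nth [::] ts l))|
     <= accum u ((size t0).-1 + size ts) * `|p t0|
        + \sum_(l < size ts)
            accum u ((size (nth [::] ts l)).-1 + (size ts - l))
            * `|p (nth [::] ts l)|.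
Proof.
move=> u_ge0 num_ts e p; rewrite {}/e.
elim/last_ind: ts num_ts => [|ts t IHts] num_ts.
  have [] := num_ts t0 (mem_head _ _).
  case: t0 {num_ts} => // x t _ num_t safe_t.
  by rewrite !big_ord0 !addr0 addn0; exact: fl_chain_mul_err.
rewrite map_cons map_rcons /chain foldl_rcons /= => -[safe_ts safe_t safe].
have [|num_v le_v] := IHts _ safe_ts.
  by move=> t' t'_ts; apply: num_ts;
    rewrite -rcons_cons mem_rcons inE t'_ts orbT.
have [|t_neq0 num_t] := num_ts t;
  first by rewrite -rcons_cons mem_rcons mem_head.
have [num_pt le_pt] : let v := flval F (chain Mul (map (@Lit R) t)) in
    fp_num F v /\ `|v - p t| <= accum u (size t).-1 * `|p t|.
  by case: t t_neq0 num_t safe_t {num_ts safe} => // x t _ num_t safe_t;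
    exact: fl_chain_mul_err.
have [num_v' le_v'] := fp_op_num_err num_v num_pt safe; split=> //.
rewrite size_rcons !big_ord_recr /= !nth_rcons ltnn eqxx subSnn addn1.
rewrite (eq_bigr (fun l : 'I__ => p (nth [::] ts l))) => [|l _]; last first.
  by rewrite nth_rcons ltn_ord.
rewrite [X in _ <= _ + (X + _)](eq_bigr (fun l : 'I_(size ts) => (1 + u) *
    (accum u ((size (nth [::] ts l)).-1 + (size ts - l)) * `|p (nth [::] ts l)|)
    + u * `|p (nth [::] ts l)|)) => [|l _]; last first.
  rewrite nth_rcons ltn_ord subSn 1?ltnW // addnS accumS; ring.
rewrite addnS !accumS big_split /= -!big_distrr /=.
move: le_v le_pt le_v'; rewrite -/(chain Mul (map (@Lit R) t)) /=.
set v := flval _ _; set pt := flval _ _; move: (fp_op _ _ _ _) => v'.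
set S := \sum_(l < _) p _; set W := \sum_(l < _) accum _ _ * _.
set N := \sum_(l < _) `|_| => le_v le_pt le_v'.
have S_le : `|S| <= N by apply: ler_norm_sum.
have vpt_le : `|v + pt| <= `|v - (p t0 + S)| + `|pt - p t| + (`|p t0| + N + `|p
  t|).
  have -> : v + pt = (v - (p t0 + S)) + (pt - p t) + (p t0 + S + p t) by ring.
  apply: le_trans (ler_normD _ _) (lerD (ler_normD _ _) _).
  apply: le_trans (ler_normD _ _) (lerD _ (lexx _)).
  by apply: le_trans (ler_normD _ _) _; rewrite lerD2l.
have tri : `|v' - (p t0 + (S + p t))|
    <= `|v' - (v + pt)| + (`|v - (p t0 + S)| + `|pt - p t|).
  have -> : v' - (p t0 + (S + p t))
    = (v' - (v + pt)) + ((v - (p t0 + S)) + (pt - p t)) by ring.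
  by apply: le_trans (ler_normD _ _) _; rewrite lerD2l ler_normD.
apply: le_trans tri _; have := ler_wpM2l u_ge0 vpt_le.
have := ler_wpM2l u_ge0 le_v; have := ler_wpM2l u_ge0 le_pt.
lra.
Qed.

Lemma all2_perm_eq_nth (T : eqType) (s t : seq (seq T)) :
  all2 perm_eq s t ->
  size s = size t /\ forall l, perm_eq (nth [::] s l) (nth [::] t l).
Proof.
elim: s t => [|x s IHs] [|y t] //=.
case/andP=> eq_xy /IHs[eq_size eq_st]; split; first by rewrite eq_size.
by case.
Qed.

Lemma entry_num (R : realType) (u : R) (F : fp_arith u) (n : nat)
    (Ht : 'M[R]_n) (p q : nat) :
  (forall i j, fp_num F (Ht i j)) -> (1 <= p <= n)%N -> (1 <= q <= n)%N ->
  fp_num F (entry Ht p q).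
Proof.
case: p q => [|p] [|q] // num_H /= lt_p lt_q.
by rewrite /entry /= !insubT.
Qed.

Lemma b_factors_num (R : realType) (u : R) (F : fp_arith u) (n : nat)
    (Ht : 'M[R]_n) (i m : nat) :
  (forall i j, fp_num F (Ht i j)) -> (1 <= m < i)%N -> (i <= n)%N ->
  {in b_factors Ht i m, forall y, fp_num F y}.
Proof.
move=> num_H /andP[m_gt0 lt_mi] le_in y; rewrite inE => /orP[/eqP->|].
  apply: entry_num => //; rewrite ?le_in ?andbT ?(leq_ltn_trans _ lt_mi) //.
  by rewrite subn_gt0 lt_mi (leq_trans (leq_subr _ _)).
case/mapP=> r; rewrite mem_iota add0n => /andP[_ lt_rm] ->.
have lt_ri : (r.+1 < i)%N := leq_ltn_trans lt_rm lt_mi.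
have le_irn : (i - r <= n)%N := leq_trans (leq_subr _ _) le_in.
apply: entry_num => //; first by rewrite subn_gt0 ltnW.
by rewrite (leq_trans (leq_pred _)) // andbT -subnS subn_gt0.
Qed.

Lemma size_b_factors (R : realType) (n : nat) (Ht : 'M[R]_n) (i m : nat) :
  size (b_factors Ht i m) = m.+1.
Proof. by rewrite /= size_map size_iota. Qed.

(** Counting roundings over $j-2$ additions: the term $m=1$ has $2+(j-2)=j$, a term $m\ge2$ has
    $(m+1)+(j-m)=j+1$, and the last one $(j-1)+1=j$. Reordering factors changes neither the counts
    nor the exact products. *)
Lemma labudde_sum_err (R : realType) (u : R) (F : fp_arith u) (n : nat)
    (Ht : 'M[R]_n) (c : nat -> nat -> R) (j i : nat) (s : R) :
  0 <= u -> j.+1%:R * u < 1 -> (3 <= j <= i)%N -> (i <= n)%N ->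
  (forall p q, fp_num F (Ht p q)) ->
  (forall m, (1 <= m < j.-1)%N -> fp_num F (c (j - m - 1)%N (i - m - 1)%N)) ->
  computes_sum_prods F (labudde_terms Ht c j i) s ->
  fp_num F s
  /\ `|s - (\sum_(1 <= m < j.-1) b_elt Ht i m * c (j - m - 1)%N (i - m - 1)%N
            + b_elt Ht i (j - 1))|
     <= gam u j.+1
          * \sum_(2 <= m < j.-1) `|b_elt Ht i m * c (j - m - 1)%N (i - m - 1)%N|
        + gam u j * (`|b_elt Ht i 1 * c (j - 2)%N (i - 2)%N|
                     + `|b_elt Ht i (j - 1)|).
Proof.
case: j => [|[|[|j]]] // u_ge0 ju_lt1 /= le_ji le_in num_H num_c.
case=> ts' perm_ts [safe ->].
have {perm_ts} [size_ts nth_ts] := all2_perm_eq_nth perm_ts.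
pose f m := rcons (b_factors Ht i m) (c (j.+3 - m - 1)%N (i - m - 1)%N).
pose ts := rcons [seq f m | m <- iota 2 j] (b_factors Ht i j.+2).
have termsE : labudde_terms Ht c j.+3 i = f 1%N :: ts.
  by rewrite /labudde_terms !subn1 subn2.
rewrite termsE in size_ts nth_ts.
have size_tsE : size ts = j.+1 by rewrite size_rcons size_map size_iota.
have num_f m : (1 <= m < j.+2)%N -> {in f m, forall y, fp_num F y}.
  move=> lt_m y; rewrite mem_rcons inE => /orP[/eqP->|]; first exact: num_c.
  case/andP: lt_m => m_gt0 lt_mj.
  by apply: b_factors_num; rewrite ?m_gt0 ?(leq_trans lt_mj) // ltnW.
have f_neq0 m : f m != [::] by rewrite -size_eq0 size_rcons.
have num_ts l : (l < j.+2)%N -> nth [::] (f 1%N :: ts) l != [::]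
    /\ {in nth [::] (f 1%N :: ts) l, forall y, fp_num F y}.
  case: l => [_|l] /=; first by split; [exact: f_neq0 | exact: num_f].
  rewrite ltnS nth_rcons size_map size_iota ltnS leq_eqVlt.
  case/orP=> [/eqP->|lt_lj].
    by rewrite ltnn eqxx; split=> //; apply: b_factors_num.
  rewrite lt_lj (nth_map 0%N) ?size_iota // nth_iota // add2n.
  by split; [exact: f_neq0 | apply: num_f; rewrite /= !ltnS].
case: ts' => [//|t0' ts'] in size_ts nth_ts safe *.
case: size_ts => size_ts; rewrite size_tsE in size_ts.
have num_ts' : {in t0' :: ts', forall t, t != [::]
     /\ {in t, forall y, fp_num F y}}.
  move=> t /(nthP [::])[l]; rewrite /= ltnS size_ts => lt_l <-.
  have [neq0 num_t] := num_ts l lt_l; split.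
    by rewrite -size_eq0 (perm_size (nth_ts l)) size_eq0.
  by move=> y; rewrite (perm_mem (nth_ts l)); apply: num_t.
have [num_s le_s] := fl_chain_add_err u_ge0 num_ts' safe; split=> //.
set v := flval _ _ in le_s *; rewrite size_ts in le_s.
have nth_ts0 := nth_ts 0%N; rewrite /= in nth_ts0.
have nth_tsS l := nth_ts l.+1; rewrite /= in nth_tsS.
rewrite (perm_size nth_ts0) (perm_big _ nth_ts0) in le_s.
have prod_f m : \prod_(y <- f m) y
    = b_elt Ht i m * c (j.+3 - m - 1)%N (i - m - 1)%N.
  by rewrite /f -cats1 big_cat big_seq1.
have nth_f l : (l < j)%N -> nth [::] ts l = f l.+2.
  move=> lt_lj; rewrite nth_rcons size_map size_iota lt_lj.
  by rewrite (nth_map 0%N) ?size_iota // nth_iota.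
have nth_last : nth [::] ts j = b_factors Ht i j.+2.
  by rewrite nth_rcons size_map size_iota ltnn eqxx.
pose x m := b_elt Ht i m * c (j.+3 - m - 1)%N (i - m - 1)%N.
have sumE : \sum_(l < j.+1) \prod_(y <- nth [::] ts' l) y
    = \sum_(2 <= m < j.+2) x m + b_elt Ht i j.+2.
  rewrite (eq_bigr (fun l : 'I_j.+1 => \prod_(y <- nth [::] ts l) y)) => [|l _];
    last by rewrite (perm_big _ (nth_tsS l)).
  rewrite big_ord_recr /= nth_last; congr (_ + _).
  rewrite (big_addn 0 _ 2) !subSS subn0 big_mkord; apply: eq_bigr => l _.
  by rewrite nth_f // prod_f addn2.
have sum_errE : \sum_(l < j.+1) accum u ((size (nth [::] ts' l)).-1
      + (j.+1 - l)) * `|\prod_(y <- nth [::] ts' l) y|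
    = accum u j.+4 * (\sum_(2 <= m < j.+2) `|x m|)
      + accum u j.+3 * `|b_elt Ht i j.+2|.
  rewrite (eq_bigr (fun l : 'I_j.+1 => accum u ((size (nth [::] ts l)).-1
      + (j.+1 - l)) * `|\prod_(y <- nth [::] ts l) y|)) => [|l _];
    last by rewrite (perm_size (nth_tsS l)) (perm_big _ (nth_tsS l)).
  rewrite big_ord_recr /= nth_last subSnn addn1 size_b_factors; congr (_ + _).
  rewrite big_distrr (big_addn 0 _ 2) !subSS subn0 big_mkord.
  apply: eq_bigr => l _; rewrite nth_f // prod_f addn2; congr (accum u _ * _).
  rewrite size_rcons size_b_factors /= subSn 1?ltnW //.
  by rewrite !addSn addnS subnKC // ltnW.
rewrite sumE sum_errE prod_f -/(x 1%N) size_rcons size_b_factors in le_s.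
have -> : b_elt Ht i 1 * c (j.+3 - 2)%N (i - 2)%N = x 1%N.
  by rewrite /x -!subnDA.
rewrite big_ltn // -/(x 1%N) !subn1 /= -[x 1%N + _ + _]addrA.
apply: le_trans le_s _.
have le_gam m : (m <= j.+4)%N -> accum u m <= gam u m.
  move=> le_mj; apply: accum_le_gam => //; apply: le_lt_trans ju_lt1.
  by rewrite ler_wpM2r // ler_nat.
have mul_le m y : (m <= j.+4)%N -> 0 <= y -> accum u m * y <= gam u m * y.
  by move=> le_mj y_ge0; rewrite ler_wpM2r // le_gam.
have x_ge0 : 0 <= \sum_(2 <= m < j.+2) `|x m| by apply: sumr_ge0.
have := mul_le _ _ (leqnn _) x_ge0.
have := mul_le j.+3 _ (leqnSn _) (normr_ge0 (x 1%N)).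
have := mul_le j.+3 _ (leqnSn _) (normr_ge0 (b_elt Ht i j.+2)).
rewrite mulrDr; lra.
Qed.

(** [B] is the rounding error of the sum and [B'] the error inherited by it. The product [a * c1] is
    charged [u] when formed and $u(1+u)$ in the first subtraction, which is the $2u+u^2$ bounded by
    [g]. *)
Lemma labudde_step_err (R : realType) (u a c0 c1 p q s S S' v t0 t1 r0 r1 B B'
  g :
    R) :
  0 <= u -> 2 * u + u ^+ 2 <= g ->
  `|p - a * c1| <= u * `|a * c1| ->
  `|q - (c0 - p)| <= u * `|c0 - p| ->
  `|v - (q - s)| <= u * `|v| ->
  `|s - S| <= B -> `|S - S'| <= B' ->
  `|c0 - t0| <= r0 -> `|c1 - t1| <= r1 ->
  `|v - (t0 - a * t1 - S')|
    <= r0 + `|a| * r1 + B' + B + u * (`|v| + `|c0|) + g * `|a * c1|.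
Proof.
move=> u_ge0 le_g le_p le_q le_v le_s le_S le_c0 le_c1.
have le_ac : `|a * c1 - a * t1| <= `|a| * r1.
  by rewrite -mulrBr normrM ler_wpM2l.
have le_c0p : `|c0 - p| <= `|c0| + (1 + u) * `|a * c1|.
  have -> : c0 - p = c0 - (p - a * c1) - a * c1 by ring.
  apply: le_trans (ler_normB _ _) _; have := ler_normB c0 (p - a * c1).
  by move=> h; lra.
have h1 := ler_wpM2l u_ge0 le_c0p.
have h2 := ler_wpM2r (normr_ge0 (a * c1)) le_g.
move: le_p le_q le_v le_s le_S le_c0 le_ac.
rewrite !ler_norml => /andP[? ?] /andP[? ?] /andP[? ?] /andP[? ?] /andP[? ?].
by move=> /andP[? ?] /andP[? ?]; apply/andP; split; lra.
Qed.

(** On the diagonal there is no previous $\hat c_j$, so [a * c1] is charged only [u]; the final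
    negation is exact. *)
Lemma labudde_diag_step_err (R : realType) (u a c1 p s S S' v t1 r1 B B' : R) :
  `|p - a * c1| <= u * `|a * c1| ->
  `|- v - (p + s)| <= u * `|- v| ->
  `|s - S| <= B -> `|S - S'| <= B' -> `|c1 - t1| <= r1 ->
  `|v - (0 - a * t1 - S')| <= `|a| * r1 + B' + B + u * (`|v| + `|a * c1|).
Proof.
rewrite normrN => le_p le_v le_s le_S le_c1.
have le_ac : `|a * c1 - a * t1| <= `|a| * r1.
  by rewrite -mulrBr normrM ler_wpM2l.
move: le_p le_v le_s le_S le_ac.
rewrite !ler_norml => /andP[? ?] /andP[? ?] /andP[? ?] /andP[? ?] /andP[? ?].
by apply/andP; split; lra.
Qed.

Lemma sum_mul_error_le (R : realType) (b x y r : nat -> R) (l h : nat) :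
  (forall m, (l <= m < h)%N -> `|x m - y m| <= r m) ->
  `|\sum_(l <= m < h) b m * x m - \sum_(l <= m < h) b m * y m|
    <= \sum_(l <= m < h) `|b m| * r m.
Proof.
move=> le_r; rewrite -sumrB; apply: le_trans (ler_norm_sum _ _ _) _.
rewrite big_nat [leRHS]big_nat; apply: ler_sum => m lt_m.
by rewrite -mulrBr normrM ler_wpM2l // le_r.
Qed.

Lemma leading_charcoef_recr (R : realType) (n : nat) (Ht : 'M[R]_n) (j i : nat)
  :
  upper_hessenberg Ht -> (2 <= j <= i)%N ->
  leading_charcoef Ht j i
    = (if j == i then 0 else leading_charcoef Ht j i.-1)
      - entry Ht i i * leading_charcoef Ht j.-1 i.-1
      - (\sum_(1 <= m < j.-1)
           b_elt Ht i m * leading_charcoef Ht (j - m - 1) (i - m - 1)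
         + b_elt Ht i (j - 1)).
Proof.
case: j => [|[|j]] // Ht_hess /= le_ji.
rewrite leading_charcoefE ?(ltnW le_ji) // big_nat_recr //= subn1.
by rewrite subSnn leading_charcoef0 mulr1.
Qed.

Lemma b_elt1 (R : realType) (n : nat) (Ht : 'M[R]_n) (i : nat) :
  b_elt Ht i 1 = entry Ht i.-1 i * entry Ht i i.-1.
Proof. by rewrite /b_elt /b_factors /= big_cons big_seq1 subn0 subn1. Qed.

(** Induction on [i] for all [j] at once. That the computed coefficients are floating point numbers
    is carried along, as the rounding model for the next operations requires it. *)
Lemma labudde_error_le (R : realType) (u : R) (F : fp_arith u) (n k : nat)
    (Ht : 'M[R]_n) (c rho : nat -> nat -> R) :
  0 <= u -> u < 1 -> k.+1%:R * u < 1 -> (k <= n)%N ->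
  upper_hessenberg Ht -> (forall p q, fp_num F (Ht p q)) ->
  labudde_computed F k Ht c -> running_error_bounds u k Ht c rho ->
  forall i j, (i <= n)%N -> (1 <= j <= k)%N -> (j <= i)%N ->
  fp_num F (c j i) /\ `|c j i - leading_charcoef Ht j i| <= rho j i.
Proof.
move=> u_ge0 u_lt1 ku_lt1 le_kn Ht_hess num_H comp err.
have num_h p q : (1 <= p <= n)%N -> (1 <= q <= n)%N -> fp_num F (entry Ht p q).
  exact: entry_num.
have gam2 : (2 <= k)%N -> 2 * u + u ^+ 2 <= gam u 2.
  move=> k_ge2; have -> : 2 * u + u ^+ 2 = accum u 2 by rewrite /accum; ring.
  apply: accum_le_gam => //; apply: le_lt_trans ku_lt1.
  by rewrite ler_wpM2r // ler_nat ltnW.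
elim/ltn_ind => i IH j le_in /andP[j_gt0 le_jk] le_ji.
have i_gt0 : (0 < i)%N := leq_trans j_gt0 le_ji.
have {}IH i' j' : (i' < i)%N -> (1 <= j' <= j)%N -> (j' <= i')%N ->
    fp_num F (c j' i') /\ `|c j' i' - leading_charcoef Ht j' i'| <= rho j' i'.
  move=> lt_i' /andP[j'_gt0 le_j'] le_ji'; apply: IH => //.
    by rewrite (leq_trans (ltnW lt_i')).
  by rewrite j'_gt0 (leq_trans le_j').
have num_ii : fp_num F (entry Ht i i) by apply: num_h; rewrite i_gt0.
have [j1|j_neq1] := eqVneq j 1%N.
  rewrite {j le_jk le_ji j_gt0}j1 in IH *.
  have [i1|i_neq1] := eqVneq i 1%N.
    rewrite {i IH le_in i_gt0}i1 in num_ii *.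
    rewrite (lb_c11 comp) (re_11 err) leading_charcoefE //= big_geq //.
    rewrite leading_charcoef0 mulr1 sub0r subr0 subrr normr0; split=> //.
    exact: fp_numN.
  have i_ge2 : (2 <= i)%N by rewrite ltn_neqAle eq_sym i_neq1.
  have [|//||num_c le_c] := IH i.-1 1%N; rewrite ?prednK ?ltn_predRL //.
  have i_rng : (2 <= i <= n)%N by rewrite i_ge2.
  have [[_ _ safe] def_c] := lb_c1 comp i_rng.
  have [] := fp_op_num_back_err u_lt1 num_c num_ii safe.
  rewrite (re_1 err) ?i_ge2 // leading_charcoefE ?i_gt0 //= big_geq // subr0.
  rewrite leading_charcoef0 mulr1 (ltn_eqF i_ge2) -/(flval _ _) /=.
  move: def_c => /= <- num_ci le_ci; split=> //.
  apply: le_trans (ler_distD (c 1%N i.-1 - entry Ht i i) _ _) _.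
  rewrite addrC lerD //; apply: le_trans le_c; rewrite le_eqVlt.
  by rewrite (_ : _ - _ - _ = c 1%N i.-1 - leading_charcoef Ht 1 i.-1) ?eqxx
    //; ring.
have j_ge2 : (2 <= j)%N by rewrite ltn_neqAle eq_sym j_neq1.
have k_ge2 : (2 <= k)%N := leq_trans j_ge2 le_jk.
have i_ge2 : (2 <= i)%N := leq_trans j_ge2 le_ji.
have le_pi : (i.-1 <= n)%N := leq_trans (leq_pred _) le_in.
have pi_gt0 : (0 < i.-1)%N by rewrite ltn_predRL.
have lt_pi : (i.-1 < i)%N by rewrite prednK.
have [||num_c1 le_c1] := IH i.-1 j.-1 lt_pi.
- by rewrite ltn_predRL j_ge2 leq_pred.
- by rewrite -!subn1 leq_sub2r.
rewrite leading_charcoef_recr ?j_ge2 //.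
have num_pi : fp_num F (entry Ht i.-1 i) by apply: num_h;
  rewrite ?pi_gt0 ?i_gt0.
have num_ip : fp_num F (entry Ht i i.-1) by apply: num_h;
  rewrite ?pi_gt0 ?i_gt0.
have [j2|j_neq2] := eqVneq j 2%N.
  rewrite {j le_jk j_gt0 j_neq1 j_ge2}j2 /= in IH le_ji num_c1 le_c1 *.
  rewrite big_geq // add0r b_elt1.
  have [i2|i_neq2] := eqVneq 2%N i.
    subst i; rewrite /= in num_ii num_pi num_ip num_c1 *.
    have num_11 : fp_num F (entry Ht 1 1).
      by rewrite -[entry _ _ _]opprK -(lb_c11 comp); apply: fp_numN.
    have [/= [[_ _ safe1] [_ _ safe2] safe] ->] := lb_c22 comp k_ge2.
    have [num_p le_p] := fp_op_num_err num_11 num_ii safe1.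
    have [num_s le_s] := fp_op_num_err num_pi num_ip safe2.
    have [num_v le_v] := fp_op_num_back_err u_lt1 num_p num_s safe.
    split=> //; rewrite (re_22 err) // leading_charcoefE // big_geq //=.
    rewrite leading_charcoef0; have [/= _ def_v] := lb_c22 comp k_ge2;
      rewrite -def_v /= in le_v.
    rewrite [entry Ht 2 2 * entry Ht 1 1]mulrC.
    move: le_p le_s le_v; rewrite /= !ler_norml.
    by move=> /andP[? ?] /andP[? ?] /andP[? ?]; apply/andP; split; lra.
  have i_ge3 : (3 <= i)%N by rewrite ltn_neqAle i_neq2.
  have [//||num_c0 le_c0] := IH i.-1 2%N lt_pi; first by rewrite ltn_predRL.
  have i_rng : (3 <= i <= n)%N by rewrite i_ge3.
  have [[/= [_ [_ _ safe1] safe3] [_ _ safe2] safe] def_c] :=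
    lb_c2 comp k_ge2 i_rng.
  have [num_p le_p] := fp_op_num_err num_ii num_c1 safe1.
  have [num_q le_q] := fp_op_num_err num_c0 num_p safe3.
  have [num_s le_s] := fp_op_num_err num_pi num_ip safe2.
  have [] := fp_op_num_back_err u_lt1 num_q num_s safe.
  rewrite /= in def_c; rewrite -def_c => num_v le_v; split=> //.
  (* For $j=2$ the sum is a single product of matrix entries, so it inherits no error. *)
  have S0 : `|entry Ht i.-1 i * entry Ht i i.-1
      - entry Ht i.-1 i * entry Ht i i.-1| <= 0 by rewrite subrr normr0.
  apply: le_trans (labudde_step_err u_ge0 (gam2 k_ge2) le_p le_q le_v le_s S0
    le_c0 le_c1) _.
  rewrite (re_2 err k_ge2 i_rng) /=; lra.
have j_ge3 : (3 <= j)%N by rewrite ltn_neqAle eq_sym j_neq2.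
have IHm m : (1 <= m < j.-1)%N ->
    fp_num F (c (j - m - 1)%N (i - m - 1)%N)
    /\ `|c (j - m - 1)%N (i - m - 1)%N
         - leading_charcoef Ht (j - m - 1) (i - m - 1)|
       <= rho (j - m - 1)%N (i - m - 1)%N.
  rewrite ltn_predRL => /andP[m_gt0 lt_mj].
  apply: IH; last by rewrite !leq_sub2r.
    by rewrite -subnDA ltn_subrL addn1.
  by rewrite -subnDA addn1 subn_gt0 lt_mj leq_subr.
have ju_lt1 : j.+1%:R * u < 1.
  by apply: le_lt_trans ku_lt1; rewrite ler_wpM2r // ler_nat.
have sum_err s (comp_s : computes_sum_prods F (labudde_terms Ht c j i) s) :=
  labudde_sum_err u_ge0 ju_lt1 (introT andP (conj j_ge3 le_ji)) le_in num_H
    (fun m lt_m => proj1 (IHm m lt_m)) comp_s.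
have S_err : `|\sum_(1 <= m < j.-1) b_elt Ht i m * c (j - m - 1)%N (i - m - 1)%N
      + b_elt Ht i (j - 1)
    - (\sum_(1 <= m < j.-1)
         b_elt Ht i m * leading_charcoef Ht (j - m - 1) (i - m - 1)
       + b_elt Ht i (j - 1))|
    <= \sum_(1 <= m < j.-1) `|b_elt Ht i m| * rho (j - m - 1)%N (i - m - 1)%N.
  rewrite opprD addrACA subrr addr0.
  by apply: sum_mul_error_le => m lt_m; case: (IHm m lt_m).
have [eq_ji|ne_ji] := eqVneq j i.
  subst i; have j_rng : (3 <= j <= k)%N by rewrite j_ge3.
  have [s comp_s [[/= [_ _ safe1] _ safe] def_c]] := lb_cii comp j_rng.
  have [num_s le_s] := sum_err s comp_s.
  have [num_p le_p] := fp_op_num_err num_ii num_c1 safe1.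
  have [] := fp_op_num_back_err u_lt1 num_p num_s safe.
  rewrite /= in def_c; rewrite -def_c => num_v le_v.
  split; first by rewrite -[c j j]opprK; apply: fp_numN.
  apply: le_trans (labudde_diag_step_err le_p le_v le_s S_err le_c1) _.
  rewrite (re_ii err j_rng); lra.
have i_rng : (j.+1 <= i <= n)%N by rewrite ltn_neqAle ne_ji le_ji.
have j_rng : (3 <= j <= k)%N by rewrite j_ge3.
have lt_ji : (j < i)%N by case/andP: i_rng.
have [||num_c0 le_c0] := IH i.-1 j lt_pi; rewrite ?j_gt0 ?leqnn ?ltn_predRL //.
  by rewrite -ltnS prednK.
have [s comp_s [[/= [_ [_ _ safe1] safe2] _ safe] def_c]] :=
  lb_cji comp j_rng i_rng.
have [num_s le_s] := sum_err s comp_s.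
have [num_p le_p] := fp_op_num_err num_ii num_c1 safe1.
have [num_q le_q] := fp_op_num_err num_c0 num_p safe2.
have [] := fp_op_num_back_err u_lt1 num_q num_s safe.
rewrite /= in def_c; rewrite -def_c => num_v le_v; split=> //.
apply: le_trans (labudde_step_err u_ge0 (gam2 k_ge2) le_p le_q le_v le_s S_err
  le_c0 le_c1) _.
rewrite (re_ji err j_rng i_rng); lra.
Qed.

(** * Total error as rounding error plus perturbation *)

Theorem theorem6p2 (R : realType) (n : nat) (A : 'M[R]_n)
    (sigma : 'I_n -> R) (nu2 : R) :
  singular_values A sigma -> 0 < nu2 ->
  exists C u0 : R, 0 < u0 /\
  forall (k : nat) (u : R) (F : fp_arith u) (H E Ht : 'M[R]_n)
         (c rho : nat -> nat -> R),
    (1 <= k <= n)%N ->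
    0 < u -> u < u0 -> n%:R * u < 1 -> k.+1%:R * u < 1 ->
    frob A < 1 / (nu2 * n%:R ^+ 2 * u) ->
    upper_hessenberg H -> orthogonally_similar H A ->
    upper_hessenberg Ht -> Ht = H + E ->
    frob E <= nu2 * n%:R ^+ 2 * frob A * u ->
    (forall i j, fp_num F (A i j)) ->
    (forall i j, fp_num F (Ht i j)) ->
    labudde_computed F k Ht c ->
    running_error_bounds u k Ht c rho ->
    forall j, (1 <= j <= k)%N ->
      `|c j n - charcoef A j|
        <= 'C(n, j)%:R * elem_sym sigma j.-1 j * (nu2 * n%:R ^+ 2 * frob A * u)
           + rho j n + C * u ^+ 2.
Proof.
move=> sv_A nu2_gt0; pose K := nu2 * n%:R ^+ 2 * frob A.
have fA_ge0 := frob_ge0 A.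
have K_ge0 : 0 <= K by rewrite !mulr_ge0 ?exprn_ge0 // ltW.
(* One [M] serves both $\|H\|_F=\|A\|_F\le M$ and $\|E\|_F\le Ku\le Mu$. *)
pose M := 1 + frob A + K; have M_ge1 : 1 <= M by rewrite /M; lra.
have M_ge0 : 0 <= M := le_trans ler01 M_ge1.
have Mn_ge0 : 0 <= 2 * M * n%:R by rewrite !mulr_ge0.
(* The base is at least 1, so the power [n] dominates $(2Mn)^j$ for every $j\le n$; the constant
   depends only on [n], [A] and [nu2]. *)
exists ((1 + 2 * M * n%:R) ^+ n), 1; split=> //.
move=> k u F H E Ht c rho /andP[k_gt0 le_kn] u_gt0 u_lt1 _ ku_lt1 _ _ sim_H.
move=> Ht_hess def_Ht le_E _ num_Ht comp err [//|r] /andP[_ lt_rk].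
have lt_rn : (r < n)%N := leq_trans lt_rk le_kn.
have [char_H sv_H frob_H] := orthogonally_similar_invariants sim_H sv_A.
have u_ge0 := ltW u_gt0.
have j_rng : (1 <= r.+1 <= k)%N by [].
have [_ le_round] := labudde_error_le u_ge0 u_lt1 ku_lt1 le_kn Ht_hess num_Ht
  comp err (leqnn n) j_rng lt_rn.
have u01 : 0 <= u <= 1 by rewrite u_ge0 ltW.
have char_coefH : charcoef H r.+1 = charcoef A r.+1 by rewrite /charcoef char_H.
have : `|charcoef Ht r.+1 - charcoef H r.+1|
    <= 'C(n, r.+1)%:R * elem_sym sigma r r.+1 * frob E
       + (2 * M * n%:R) ^+ r.+1 * u ^+ 2.
  rewrite def_Ht; apply: charcoefD_le => //; first by rewrite frob_H /M; lra.
  by apply: le_trans le_E _; rewrite ler_wpM2r // -/K /M; lra.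
rewrite char_coefH charcoef_leading => le_pert.
have sigma_ge0 : forall i, 0 <= sigma i by case: sv_A.
have coef_ge0 : 0 <= 'C(n, r.+1)%:R * elem_sym sigma r r.+1.
  by rewrite mulr_ge0 ?elem_sym_ge0.
have le_lin := ler_wpM2l coef_ge0 le_E.
have le_C : (2 * M * n%:R) ^+ r.+1 <= (1 + 2 * M * n%:R) ^+ n.
  apply: le_trans (_ : (1 + 2 * M * n%:R) ^+ r.+1 <= _).
    by rewrite lerXn2r ?nnegrE ?lerDr ?addr_ge0.
  by rewrite ler_weXn2l ?lerDl.
have le_quad := ler_wpM2r (sqr_ge0 u) le_C.
(* The exact coefficient of $\tilde H$ is the intermediate point. *)
apply: le_trans (ler_distD (leading_charcoef Ht r.+1 n) _ _) _.
by rewrite /=; lra.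
Qed.
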